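(* Let $n,t\geq 1$, let $f_1,\dots,f_t\in\mathbb{C}[x_1,\dots,x_n]$ be irreducible (in particular non-constant) and pairwise coprime polynomials, let $a_1,\dots,a_t\geq 1$ be integers, and let $$A=\frac{\mathbb{C}[u,v,x_1,\dots,x_n]}{(uv-f_1^{a_1}\cdots f_t^{a_t})}.$$ If $A$ has Krull dimension $2$, then there is an isomorphism of abelian groups $$\mathrm{G}_0(A)\cong\mathbb{Z}\oplus\mathrm{Cl}(A).$$
   Context: For a noetherian ring $R$, $\mathrm{G}_0(R)=\mathrm{K}_0(\mathrm{mod}\,R)$ is the Grothendieck group of the abelian category of finitely generated $R$-modules. The ring $A$ is a normal noetherian integral domain and $\mathrm{Cl}(A)$ denotes its divisor class group (Weil divisors modulo principal divisors). *)

(* Defs.v *)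
From HB Require Import structures.
From mathcomp Require Import all_boot all_order all_algebra.
From mathcomp Require Import generic_quotient ring_quotient.
From mathcomp Require Import boolp reals complex freeg mpoly.

Set Implicit Arguments.
Unset Strict Implicit.
Unset Printing Implicit Defensive.

Import GRing.Theory.

Local Open Scope ring_scope.
Local Open Scope quotient_scope.

Local Notation "{ 'quot' N }" := (@Quotient.quot _ N) (only parsing) : type_scope.

Section Span.
Variables (V : zmodType) (S : V -> Prop).

Definition zspan : {pred V} := fun x =>
  `[< forall N : {pred V}, zmod_closed N -> (forall y, S y -> y \in N) ->
      x \in N >].

Lemma zspan_zmod_closed : zmod_closed zspan.
Proof.
split=> [|x y /asboolP hx /asboolP hy]; apply/asboolP => N Nz SN.
  by case: Nz.
by case: (Nz) => _; apply; [exact: hx | exact: hy].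
Qed.

HB.instance Definition _ := GRing.isZmodClosed.Build V zspan zspan_zmod_closed.

End Span.

Section QuotientModule.
Variables (A : nzRingType) (V : lmodType A) (N : {pred V}).
Variable N_closed : submod_closed N.

(* The proof argument carries the zmodClosed structure needed by the quotient. *)
Definition submod_pred of submod_closed N : {pred V} := N.

HB.instance Definition _ :=
  GRing.isZmodClosed.Build V (submod_pred N_closed)
    (GRing.submod_closedB N_closed).

Definition quotmod : Type := {quot (submod_pred N_closed)}.

HB.instance Definition _ := GRing.Zmodule.on quotmod.

Definition quotmod_pi (x : V) : quotmod := \pi_{quot (submod_pred N_closed)} x.
Definition quotmod_scale (c : A) (x : quotmod) : quotmod :=
  quotmod_pi (c *: repr (x : {quot (submod_pred N_closed)})).

Lemma quotmod_piP x y : quotmod_pi x = quotmod_pi y <-> x - y \in N.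
Proof.
rewrite -[_ \in N]/(_ \in submod_pred N_closed) Quotient.idealrBE.
by split=> /eqP.
Qed.

Lemma quotmod_pi_surj (x : quotmod) : exists y, quotmod_pi y = x.
Proof.
exists (repr (x : {quot (submod_pred N_closed)})).
by rewrite /quotmod_pi reprK.
Qed.

Lemma quotmod_piD x y : quotmod_pi (x + y) = quotmod_pi x + quotmod_pi y.
Proof. exact: (raddfD \pi_{quot (submod_pred N_closed)}). Qed.

Lemma quotmod_piZ c x : quotmod_pi (c *: x) = quotmod_scale c (quotmod_pi x).
Proof.
apply/quotmod_piP; rewrite -scalerBr.
apply: (GRing.subsemimod_closedZ (GRing.submod_closed_semi N_closed)).
by apply/quotmod_piP; rewrite /quotmod_pi reprK.
Qed.

Fact quotmod_scaleA c d x :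
  quotmod_scale c (quotmod_scale d x) = quotmod_scale (c * d) x.
Proof.
by have [y <-] := quotmod_pi_surj x; rewrite -!quotmod_piZ scalerA.
Qed.

Fact quotmod_scale1 : left_id 1 quotmod_scale.
Proof.
by move=> x; have [y <-] := quotmod_pi_surj x; rewrite -quotmod_piZ scale1r.
Qed.

Fact quotmod_scaleDr : right_distributive quotmod_scale +%R.
Proof.
move=> c x y; have [u <-] := quotmod_pi_surj x.
have [w <-] := quotmod_pi_surj y.
by rewrite -quotmod_piD -!quotmod_piZ -quotmod_piD scalerDr.
Qed.

Fact quotmod_scaleDl x :
  {morph (fun c => quotmod_scale c x) : c d / c + d}.
Proof.
move=> c d; have [u <-] := quotmod_pi_surj x.
by rewrite -!quotmod_piZ -quotmod_piD scalerDl.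
Qed.

HB.instance Definition _ := GRing.Zmodule_isLmodule.Build A quotmod
  quotmod_scaleA quotmod_scale1 quotmod_scaleDr quotmod_scaleDl.

Fact quotmod_pi_linear : linear quotmod_pi.
Proof. by move=> c x y; rewrite quotmod_piD quotmod_piZ. Qed.

HB.instance Definition _ :=
  GRing.isLinear.Build A V quotmod _ quotmod_pi quotmod_pi_linear.

End QuotientModule.

Section GrothendieckGroup.
Variable A : comNzRingType.

(* The finitely generated A-modules form a proper class; the Grothendieck     *)
(* group is built on the essentially equivalent set of modules A^k / N with   *)
(* N a submodule of A^k.  Lemma fgmod_ess_surj shows that every finitely      *)
(* generated A-module is isomorphic to one of these.  Here and below, fields  *)
(* of type T -> bool stand for {pred T}, which lives in too large a universe  *)
(* for fgmod to be a choiceType.                                              *)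
Record fgmod := FgMod {
  fg_rank : nat;
  fg_rels : 'rV[A]_fg_rank -> bool;
  fg_relsP : submod_closed fg_rels
}.

HB.instance Definition _ := gen_eqMixin fgmod.
HB.instance Definition _ := gen_choiceMixin fgmod.

Definition fgmod_lmod (M : fgmod) : lmodType A := quotmod (fg_relsP M).

Coercion fgmod_lmod : fgmod >-> GRing.Lmodule.type.

Definition finitely_generated (M : lmodType A) : Prop :=
  exists (k : nat) (g : 'I_k -> M), forall x : M,
    exists c : 'I_k -> A, x = \sum_(i < k) c i *: g i.

Lemma fgmod_ess_surj (M : lmodType A) : finitely_generated M ->
  exists (N : fgmod) (phi : {linear N -> M}), bijective phi.
Proof.
case=> k [g gM].
pose psi (x : 'rV[A]_k) : M := \sum_(i < k) x 0 i *: g i.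
have psiL : linear psi.
  move=> c x y; rewrite /psi scaler_sumr -big_split; apply: eq_bigr => i _.
  by rewrite !mxE scalerDl scalerA.
have psiB x y : psi (x - y) = psi x - psi y.
  by have := psiL (-1) y x; rewrite !scaleN1r ![- _ + _]addrC.
pose K : {pred 'rV[A]_k} := fun x => psi x == 0.
have K_closed : submod_closed K.
  split=> [|c x y]; first by rewrite -[0](subrr 0) unfold_in psiB subrr.
  by rewrite !unfold_in psiL => /eqP -> /eqP ->; rewrite scaler0 addr0.
pose N := FgMod K_closed.
have piE (x y : 'rV[A]_k) : quotmod_pi K_closed x = quotmod_pi K_closed y -> psi x = psi y.
  by move/quotmod_piP; rewrite unfold_in psiB subr_eq0 => /eqP.
have secP (q : N) : {x : 'rV[A]_k | quotmod_pi K_closed x = q}.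
  exact: cid (quotmod_pi_surj q).
pose phi (q : N) : M := psi (sval (secP q)).
have phiE x : phi (quotmod_pi K_closed x) = psi x.
  by apply: piE; case: (secP _).
have phiL : linear phi.
  move=> c x y; case: (secP x) (secP y) => u <- [w <-].
  by rewrite -linearP !phiE psiL.
have psi_surj z : {x | psi x = z}.
  apply: cid; have [c ->] := gM z; exists (\row_i c i).
  by apply: eq_bigr => i _; rewrite mxE.
pose phiM := GRing.isLinear.Build _ _ _ _ phi phiL.
pose phi' : {linear N -> M} := HB.pack phi phiM.
exists N, phi', (fun z => quotmod_pi K_closed (sval (psi_surj z))) => [q|z] /=.
  case: (secP q) => x <-; rewrite phiE; case: (psi_surj _) => y /= yx.
  by apply/quotmod_piP; rewrite unfold_in psiB yx subrr.
by rewrite phiE; case: (psi_surj z).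
Qed.

Definition short_exact (M' M M'' : lmodType A)
    (i : {linear M' -> M}) (p : {linear M -> M''}) : Prop :=
  [/\ injective i, (forall z, exists y, p y = z)
    & forall y, p y = 0 <-> exists x, i x = y].

Definition ses_relation (D : {freeg fgmod}) : Prop :=
  exists (M' M M'' : fgmod) (i : {linear M' -> M}) (p : {linear M -> M''}),
    short_exact i p /\ D = << M >> - << M' >> - << M'' >>.

Definition G0 : zmodType := {quot zspan ses_relation}.

End GrothendieckGroup.

Section Ideals.
Variable A : comNzRingType.
Implicit Types (P Q : {pred A}) (x y : A) (d e h m : nat).

Definition prime_ideal P : Prop := idealr_closed P /\ prime_idealr_closed P.

Definition strict_sub P Q : Prop :=
  {subset P <= Q} /\ ~ {subset Q <= P}.

Definition prime_chain d (c : 'I_d.+1 -> {pred A}) : Prop :=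
  (forall i, prime_ideal (c i)) /\
  (forall i j : 'I_d.+1, (i < j)%N -> strict_sub (c i) (c j)).

Definition has_krull_dim d : Prop :=
  (exists c : 'I_d.+1 -> {pred A}, prime_chain c) /\
  (forall e (c : 'I_e.+1 -> {pred A}), prime_chain c -> (e <= d)%N).

Definition has_height P h : Prop :=
  (exists2 c : 'I_h.+1 -> {pred A}, prime_chain c & c ord_max =i P) /\
  (forall e (c : 'I_e.+1 -> {pred A}),
     prime_chain c -> c ord_max =i P -> (e <= h)%N).

Definition ideal_pow P m x : Prop :=
  exists (r : nat) (b : 'I_r -> A) (y : 'I_r -> 'I_m -> A),
    (forall i j, y i j \in P) /\
    x = \sum_(i < r) b i * \prod_(j < m) y i j.

(* For P prime in a domain A, this says x / 1 \in (P A_P)^m, where A_P is     *)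
(* the localization of A at P.                                                *)
Definition in_local_pow P m x : Prop :=
  exists2 s, s \notin P & ideal_pow P m (s * x).

(* When A is a normal noetherian domain and P is a prime of height one, A_P   *)
(* is a discrete valuation ring, and this says that x has valuation m.  It is *)
(* a relation, not a function, so that no junk value is needed when x = 0.    *)
Definition has_ord P x m : Prop :=
  in_local_pow P m x /\ ~ in_local_pow P m.+1 x.

Record height1_prime := Height1Prime {
  h1_pred :> A -> bool;
  h1_prime : prime_ideal h1_pred;
  h1_height : has_height h1_pred 1
}.

HB.instance Definition _ := gen_eqMixin height1_prime.
HB.instance Definition _ := gen_choiceMixin height1_prime.

(* D is the divisor of the nonzero element x / y of the fraction field of A.  *)
Definition principal_divisor (D : {freeg height1_prime}) : Prop :=
  exists x y : A, [/\ x != 0, y != 0 & forall p : height1_prime,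
    exists i j : nat,
      [/\ has_ord p x i, has_ord p y j & coeff p D = i%:Z - j%:Z]].

Definition Cl : zmodType := {quot zspan principal_divisor}.

End Ideals.

Section Divisibility.
Variable D : idomainType.

Definition irreducible_elt (p : D) : Prop :=
  [/\ p != 0, p \isn't a GRing.unit
    & forall x y, p = x * y -> x \is a GRing.unit \/ y \is a GRing.unit].

(* Coprime means without common factor, not comaximal.                        *)
Definition coprime_elt (p q : D) : Prop :=
  forall d x y, p = d * x -> q = d * y -> d \is a GRing.unit.

End Divisibility.

Section HypersurfaceRing.
Variables (K : fieldType) (n t : nat).
Variables (f : 'I_t -> {mpoly K[n]}) (a : 'I_t -> nat).

(* The variables of {mpoly K[2 + n]} are u, v, x_1, ..., x_n in this order.   *)
Definition var_u : {mpoly K[2 + n]} := 'X_(lshift n ord0).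
Definition var_v : {mpoly K[2 + n]} := 'X_(lshift n ord_max).
Definition embed_x (p : {mpoly K[n]}) : {mpoly K[2 + n]} :=
  p \mPo [tuple 'X_(rshift 2 i) | i < n].

Definition hyp_eqn : {mpoly K[2 + n]} :=
  var_u * var_v - \prod_(i < t) embed_x (f i) ^+ a i.

Definition hyp_ideal : {pred {mpoly K[2 + n]}} := fun p =>
  `[< exists q, p = q * hyp_eqn >].

Fact hyp_ideal_closed : idealr_closed hyp_ideal.
Proof.
split.
- by apply/asboolP; exists 0; rewrite mul0r.
- apply/asboolP => -[q]; pose F := \prod_(i < t) embed_x (f i) ^+ a i.
  pose v0 (i : 'I_(2 + n)) : K :=
    if split i is inl j then if j == ord0 then 1 else F.@[fun=> 0] else 0.
  have F0 (w1 w2 : 'I_(2 + n) -> K) :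
      (forall i, w1 (rshift 2 i) = w2 (rshift 2 i)) -> F.@[w1] = F.@[w2].
    move=> h; rewrite /F !rmorph_prod; apply: eq_bigr => i _.
    rewrite !rmorphXn /= /embed_x !comp_mpoly_meval; congr (_ ^+ _).
    by apply: meval_eq => j; rewrite !tnth_map !tnth_ord_tuple !mevalXU h.
  move/(congr1 (meval v0)); rewrite meval1 mevalM mevalB mevalM !mevalXU.
  have hs : forall i, v0 (rshift 2 i) = 0.
    by move=> i; rewrite /v0 -[rshift 2 i]/(unsplit (inr i)) unsplitK.
  have -> : v0 (lshift n ord0) = 1.
    by rewrite /v0 -[lshift n ord0]/(unsplit (inl ord0)) unsplitK.
  have -> : v0 (lshift n ord_max) = F.@[v0].
    rewrite {1}/v0 -[lshift n ord_max]/(unsplit (inl ord_max)) unsplitK /=.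
    by apply: F0 => i; rewrite hs.
  by rewrite mul1r -/F subrr mulr0 => /eqP; rewrite oner_eq0.
- move=> p x y /asboolP[q ->] /asboolP[r ->]; apply/asboolP.
  by exists (p * q + r); rewrite mulrDl mulrA.
Qed.

HB.instance Definition _ := isIdealr.Build _ hyp_ideal hyp_ideal_closed.

Definition hyp_ring : comNzRingType := {ideal_quot hyp_ideal}.

End HypersurfaceRing.

(* Main.v *)
(* For a noetherian domain A that is regular in codimension one, send A / I   *)
(* to (1, 0) if I = 0, and to (0, class of the divisor of I) otherwise, and   *)
(* extend this along filtrations with cyclic quotients to a map (rank, first  *)
(* Chern class) from G_0(A) to Z + Cl(A). Independence of the filtration      *)
(* reduces to exchanging two consecutive generators, that is to submodules N  *)
(* of A^2. If N has rank two, both filtrations compute the orders of the 2 x  *)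
(* 2 determinants of elements of N; if N has rank one, they differ by a       *)
(* principal divisor. If in addition [A/Q] = 0 for each nonzero prime Q of    *)
(* height other than one, then [A/I] = sum_p ord_p(I) [A/p] by noetherian     *)
(* induction, and p |-> [A/p] induces an inverse.                             *)
(*                                                                            *)
(* The Krull dimension of C[u, v, x_1, ..., x_n] / (u v - F) is at least 3    *)
(* for n >= 2, so n = 1. A nonzero prime of A then either meets C[x] in 0,    *)
(* and is generated, after inverting the nonzero elements of C[x] and u, by a *)
(* polynomial in u of least degree; or it contains some x - m. In the latter  *)
(* case it contains (x - m) if F(m) <> 0, or one of (x - m, u), (x - m, v)    *)
(* otherwise; these primes have height one, and modulo them A becomes C[T,    *)
(* 1/T] or C[T], a principal ideal domain, so the larger primes have class 0. *)

Require Import Defs.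
From HB Require Import structures.
From mathcomp Require Import all_boot all_order all_algebra.
From mathcomp Require Import generic_quotient ring_quotient.
From mathcomp Require Import boolp reals complex freeg mpoly.
From mathcomp Require Import ring zify.

Set Implicit Arguments.
Unset Strict Implicit.
Unset Printing Implicit Defensive.

Import GRing.Theory.

Local Open Scope ring_scope.
Local Open Scope quotient_scope.

(** * Noetherian rings *)

Section Noetherian.

(** A finitely generated module with chosen generators is filtered with cyclic quotients A / I, and
    [colon_sum] adds up the values of a function [e] of ideals along this filtration. If [e] kills
    the unit ideal and the two filtrations of each quotient of A^2 give equal sums, the sum depends
    on the module alone ([colon_sum_indep]), is additive on short exact sequences
    ([fg_invariant_ses]) and defines a map on [G0] ([G0_invariant]). The function used is [rank_c1],
    and [rank_c1_goursat] is the condition on A^2. For submodules of rank two it is checked at each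
    prime of height one, where the local ring is a discrete valuation ring and both sides are the
    order of an ideal of determinants ([goursat_ord]). In rank one, two proportional ideals have
    divisors that differ by a principal one ([cl_ideal_divisor_scale]).

    The inverse sends (1, 0) to [A] and the class of p to [A/p]. It is well defined and inverse to
    the first map because of [cyclic_class_divisor]: [A/I] is the sum of ord_p(I) [A/p] for every
    nonzero ideal I. [G0_iso_Cl] collects this for a noetherian domain with uniformizers at the
    primes of height one, in which [A/Q] = 0 for all nonzero primes Q of other heights.

    For n = 1 both conditions come from [prime_dichotomy]. A prime Q that contains some x - m
    contains a prime P such that A / P is K[T] or K[T, 1/T]. If Q is larger than P, it is generated
    modulo P by one nonzero element, so [A/Q] = [A/P] - [A/P] = 0 ([cyclic_class_over]). For n >= 2
    an explicit chain of four primes contradicts dimension two ([pres_not_dim2]). *)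

Definition is_ideal (A : comNzRingType) (I : A -> Prop) : Prop :=
  I 0 /\ forall a x y, I x -> I y -> I (a * x + y).

(** Ascending chain condition for ideals in the sense of [is_ideal], which, unlike [idealr_closed],
    admits the unit ideal. *)
Definition noetherian (A : comNzRingType) : Prop :=
  forall I : nat -> A -> Prop, (forall n, is_ideal (I n)) ->
    (forall n x, I n x -> I n.+1 x) ->
  exists N, forall n x, I n x -> I N x.

Lemma noetherian_max (A : comNzRingType) (S : (A -> Prop) -> Prop) :
  noetherian A -> (forall I, S I -> is_ideal I) -> (exists I, S I) ->
  exists2 I, S I & forall J, S J -> (forall x, I x -> J x) ->
    forall x, J x -> I x.
Proof.
move=> noethA Sid [I0 SI0]; apply: contrapT => nomax.
have step (I : {I | S I}) :
    {J : {J | S J} | (forall x, sval I x -> sval J x) /\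
                     ~ (forall x, sval J x -> sval I x)}.
  apply: cid; case: I => I SI; apply: contrapT => noJ; apply: nomax.
  exists I => // J SJ IJ; apply: contrapT => nJI; apply: noJ.
  by exists (exist _ J SJ).
pose c n := iter n (fun I => sval (step I)) (exist _ I0 SI0).
have [|n x|N cN] := noethA (fun n => sval (c n)).
- by move=> n; apply: Sid; apply: svalP.
- by have [h _] := svalP (step (c n)); apply: h.
- by have [_] := svalP (step (c N)); apply; apply: (cN N.+1).
Qed.

Lemma noetherian_ind (A : comNzRingType) (P : (A -> Prop) -> Prop) :
  noetherian A ->
  (forall I, is_ideal I ->
     (forall J, is_ideal J -> (forall x, I x -> J x) ->
        (exists2 x, J x & ~ I x) -> P J) -> P I) ->
  forall I, is_ideal I -> P I.
Proof.
move=> noethA IH I idI; apply: contrapT => nPI.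
have [||J [idJ nPJ] maxJ] :=
    @noetherian_max A (fun I => is_ideal I /\ ~ P I) noethA.
- by move=> J [].
- by exists I.
apply: nPJ; apply: IH => // K idK JK [x Kx nJx]; apply: contrapT => nPK.
by apply: nJx; apply: (maxJ K).
Qed.

Lemma chain_le (A : comNzRingType) (I : nat -> A -> Prop) :
  (forall n x, I n x -> I n.+1 x) ->
  forall m n x, (m <= n)%N -> I m x -> I n x.
Proof.
move=> incI m n x; elim: n => [|n IH]; first by rewrite leqn0 => /eqP ->.
by rewrite leq_eqVlt => /orP[/eqP -> //|/IH h /h]; apply: incI.
Qed.

Lemma field_noetherian (K : fieldType) : noetherian K.
Proof.
move=> I idI incI.
have [[N [x [Ix x0]]]|no] := pselect (exists N x, I N x /\ x != 0).
  exists N => n y _; have [I0 Ilin] := idI N.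
  by have := Ilin (y / x) x 0 Ix I0; rewrite addr0 divfK.
exists 0%N => n x Ix; have [->|x0] := eqVneq x 0; first by case: (idI 0%N).
by case: no; exists n, x.
Qed.

Lemma surj_noetherian (R S : comNzRingType) (f : {rmorphism R -> S}) :
  (forall y, exists x, f x = y) -> noetherian R -> noetherian S.
Proof.
move=> fsurj noethR I idI incI.
have [|n x|N stab] := noethR (fun n x => I n (f x)).
- move=> n; have [I0 Ilin] := idI n; split; first by rewrite rmorph0.
  by move=> a x y Ix Iy; rewrite rmorphD rmorphM; apply: Ilin.
- exact: incI.
- by exists N => n y; have [x <-] := fsurj y; apply: stab.
Qed.

(** The coefficient in degree d may vanish, that is, p may have smaller degree; this makes the set
    an ideal. *)
Definition lead_ideal (R : comNzRingType) (I : {poly R} -> Prop) (d : nat)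
    (c : R) : Prop :=
  exists p, [/\ I p, (size p <= d.+1)%N & p`_d = c].

Lemma lead_ideal_ideal (R : comNzRingType) (I : {poly R} -> Prop) d :
  is_ideal I -> is_ideal (lead_ideal I d).
Proof.
case=> I0 Ilin; split; first by exists 0; rewrite size_poly0 coef0.
move=> a _ _ [p [Ip sp <-]] [q [Iq sq <-]]; exists (a%:P * p + q).
split; [exact: Ilin | | by rewrite coefD coefCM].
rewrite (leq_trans (size_polyD _ _)) // geq_max sq andbT.
by rewrite mul_polyC (leq_trans (size_scale_leq _ _)).
Qed.

Lemma lead_ideal_shift (R : comNzRingType) (I : {poly R} -> Prop) d c :
  is_ideal I -> lead_ideal I d c -> lead_ideal I d.+1 c.
Proof.
case=> I0 Ilin [p [Ip sp <-]]; exists ('X * p); split.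
- by have := Ilin 'X p 0 Ip I0; rewrite addr0.
- rewrite mulrC; have [->|p0] := eqVneq p 0; first by rewrite mul0r size_poly0.
  by rewrite size_mulX.
- by rewrite coefXM.
Qed.

(* By cancellation of leading terms.                                          *)
Lemma lead_ideal_eq (R : comNzRingType) (I J : {poly R} -> Prop) :
  is_ideal I -> is_ideal J -> (forall p, I p -> J p) ->
  (forall d c, lead_ideal J d c -> lead_ideal I d c) ->
  forall p, J p -> I p.
Proof.
move=> [I0 Ilin] [J0 Jlin] IJ lJI p.
have [n] := ubnP (size p); elim: n p => // n IH p sp Jp.
have [p0|p0] := eqVneq p 0; first by rewrite p0.
have sp1 : size p = (size p).-1.+1 by rewrite prednK // lt0n size_poly_eq0.
have [|q [Iq sq qE]] := lJI (size p).-1 p`_(size p).-1.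
  by exists p; rewrite -sp1.
have -> : p = 1 * q + (p - q) by rewrite mul1r addrC subrK.
apply: Ilin => //; apply: IH; last first.
  by rewrite addrC -mulN1r; apply: Jlin => //; apply: IJ.
apply: leq_trans (_ : (size p).-1.+1 <= n)%N; last by rewrite -sp1.
rewrite ltnS; apply/leq_sizeP => j; rewrite leq_eqVlt => /orP[/eqP <-|lj].
  by rewrite coefB qE subrr.
rewrite coefB (nth_default _ (leq_trans sq lj)) nth_default ?subrr //.
by rewrite sp1.
Qed.

(** Hilbert's basis theorem. The diagonal chain [L n n] becomes stationary at some [d0]: in degrees
    d >= d0 a coefficient is moved up to the diagonal, brought down to d0 and shifted back to d. The
    finitely many degrees below d0 are stabilized one by one, and [lead_ideal_eq] concludes. *)
Lemma poly_noetherian (R : comNzRingType) :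
  noetherian R -> noetherian {poly R}.
Proof.
move=> noethR I idI incI.
pose L d n := lead_ideal (I n) d.
have idL d n : is_ideal (L d n) by apply: lead_ideal_ideal.
have Lmono d n m c : (n <= m)%N -> L d n c -> L d m c.
  move=> nm [p [Ip sp pd]]; exists p; split=> //.
  exact: (chain_le incI nm).
have Lshift d e n c : (d <= e)%N -> L d n c -> L e n c.
  move=> de; apply: (@chain_le _ (fun d => L d n)) de.
  by move=> k x; apply: lead_ideal_shift.
have [d0 stab0] : exists d0, forall n c, L n n c -> L d0 d0 c.
  apply: (noethR (fun n => L n n)) => [n|n x]; first exact: idL.
  by move=> /(Lshift _ n.+1 _ _ (leqnSn _)); apply: Lmono.
have [N stabN] : exists N, forall d n c, (d < d0)%N -> L d n c -> L d N c.
  elim: d0 {stab0} => [|k [N IH]]; first by exists 0%N.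
  have [||M stabM] := noethR (L k); [exact: idL | by move=> n x; apply: Lmono|].
  exists (maxn N M) => d n c; rewrite ltnS leq_eqVlt => /orP[/eqP ->|dk].
    by move/stabM; apply: Lmono; apply: leq_maxr.
  by move/(IH _ _ _ dk); apply: Lmono; apply: leq_maxl.
exists (maxn N d0) => n p Ip.
have nM := leq_maxl n (maxn N d0).
apply: (@lead_ideal_eq _ (I (maxn N d0)) (I (maxn n (maxn N d0)))) => //.
- by move=> q; apply: (chain_le incI); apply: leq_maxr.
- move=> d c; rewrite -/(L d _ c) -/(L d (maxn N d0) c).
  have [dd0 /(stabN _ _ _ dd0)|d0d] := ltnP d d0.
    by apply: Lmono; apply: leq_maxl.
  set m := maxn n _ => h.
  have /stab0 : L (maxn d m) (maxn d m) c.
    by apply: Lmono (leq_maxr _ _) _; apply: Lshift h; apply: leq_maxl.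
  by move/(Lshift _ d _ _ d0d); apply: Lmono; apply: leq_maxr.
- exact: (chain_le incI nM).
Qed.

End Noetherian.

(** * Orders of ideals at a prime with a local uniformizer *)

Section Submodules.
Variable A : comNzRingType.

Definition is_submod (V : lmodType A) (W : V -> Prop) : Prop :=
  W 0 /\ forall a x y, W x -> W y -> W (a *: x + y).

(** The annihilator of the class of x in V / W. This class generates a copy of A / [colon W x], with
    quotient V / [adjoin W x]. *)
Definition colon (V : lmodType A) (W : V -> Prop) (x : V) : A -> Prop :=
  fun a => W (a *: x).

Definition adjoin (V : lmodType A) (W : V -> Prop) (x : V) : V -> Prop :=
  fun y => exists a, W (y - a *: x).

Section Theory.
Variables (V : lmodType A) (W : V -> Prop).
Hypothesis subW : is_submod W.

Lemma submodD x y : W x -> W y -> W (x + y).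
Proof. by case: subW => _ h Wx Wy; have := h 1 x y Wx Wy; rewrite scale1r. Qed.

Lemma submodZ a x : W x -> W (a *: x).
Proof. by case: subW => W0 h Wx; have := h a x 0 Wx W0; rewrite addr0. Qed.

Lemma colon_ideal x : is_ideal (colon W x).
Proof.
case: subW => W0 Wlin; split; first by rewrite /colon scale0r.
by move=> a b c; rewrite /colon scalerDl -scalerA; apply: Wlin.
Qed.

Lemma adjoin_submod x : is_submod (adjoin W x).
Proof.
case: subW => W0 Wlin; split; first by exists 0; rewrite scale0r subr0.
move=> a y z [b Wb] [c Wc]; exists (a * b + c).
have -> : a *: y + z - (a * b + c) *: x = a *: (y - b *: x) + (z - c *: x).
  by rewrite scalerDl -scalerA scalerBr opprD addrACA.
exact: Wlin.
Qed.

Lemma sub_adjoin x y : W y -> adjoin W x y.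
Proof. by exists 0; rewrite scale0r subr0. Qed.

Lemma mem_adjoin x : adjoin W x x.
Proof. by exists 1; rewrite scale1r subrr; case: subW. Qed.

Lemma adjoin_id x : W x -> adjoin W x = W.
Proof.
move=> Wx; apply/funext => y; apply/propext; split; last exact: sub_adjoin.
by case=> a Wa; rewrite -[y](subrK (a *: x)); apply/submodD/submodZ.
Qed.

Lemma colon_full x : W x -> colon W x = (fun=> True).
Proof.
move=> Wx; apply/funext => a; apply/propext; split=> // _.
exact: submodZ.
Qed.

End Theory.

Lemma adjoinC (V : lmodType A) (W : V -> Prop) x y :
  adjoin (adjoin W x) y = adjoin (adjoin W y) x.
Proof.
by apply/funext => z; apply/propext; split=> -[a [b]] h; exists b, a;
  rewrite addrAC.
Qed.

Lemma zero_submod (V : lmodType A) : is_submod (fun x : V => x = 0).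
Proof. by split=> // a x y -> ->; rewrite scaler0 addr0. Qed.

End Submodules.

Section PrimeIdeals.
Variables (A : comNzRingType) (P : {pred A}).
Hypothesis primeP : prime_ideal P.

Lemma prime0 : 0 \in P. Proof. by case: primeP => -[]. Qed.

Lemma prime1 : 1 \notin P. Proof. by case: primeP => -[]. Qed.

Lemma primeMl a x : x \in P -> a * x \in P.
Proof.
case: primeP => -[P0 _ lin] _ Px; have := lin a x 0 Px P0.
by rewrite addr0.
Qed.

Lemma primeD x y : x \in P -> y \in P -> x + y \in P.
Proof.
by case: primeP => -[P0 _ lin] _ Px Py; have := lin 1 x y Px Py; rewrite mul1r.
Qed.

Lemma primeB x y : x \in P -> y \in P -> x - y \in P.
Proof. by move=> Px Py; rewrite primeD // -mulN1r primeMl. Qed.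

Lemma primeM x y : (x * y \in P) = (x \in P) || (y \in P).
Proof.
apply/idP/orP; first by case: primeP => _ h /h/orP.
by case=> h; [rewrite mulrC|]; apply: primeMl.
Qed.

Lemma primeX x n : x ^+ n \in P -> x \in P.
Proof.
elim: n => [|n IH]; first by rewrite expr0 (negPf prime1).
by rewrite exprS primeM => /orP[|/IH].
Qed.

End PrimeIdeals.

Section LocalOrders.
Variable A : comNzRingType.
Hypothesis domA : forall x y : A, x * y = 0 -> x = 0 \/ y = 0.
Hypothesis noethA : noetherian A.

Lemma dom_mulIf (z x y : A) : z != 0 -> x * z = y * z -> x = y.
Proof.
move=> /eqP z0 /eqP; rewrite -subr_eq0 -mulrBl => /eqP /domA[/eqP|//].
by rewrite subr_eq0 => /eqP.
Qed.

Lemma dom_mulf_neq0 (x y : A) : x != 0 -> y != 0 -> x * y != 0.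
Proof. by move=> /eqP x0 /eqP y0; apply/eqP => /domA[]. Qed.

(** With denominators cleared: q generates the maximal ideal of the localization A_P. *)
Definition local_uniformizer (P : {pred A}) (q : A) : Prop :=
  q \in P /\ forall y, y \in P -> exists s t, s \notin P /\ s * y = t * q.

Definition ideal_ord (P : {pred A}) (I : A -> Prop) (m : nat) : Prop :=
  (forall x, I x -> in_local_pow P m x) /\
  (exists2 x, I x & ~ in_local_pow P m.+1 x).

Section OnePrime.
Variables (P : {pred A}) (q : A).
Hypothesis primeP : prime_ideal P.
Hypothesis unifq : local_uniformizer P q.
Hypothesis nzP : exists2 x, x \in P & x != 0.

Let P1 := prime1 primeP.
Let PM := primeMl primeP.
Let nPM s t : s \notin P -> t \notin P -> s * t \notin P.
Proof. by move=> Ps Pt; rewrite primeM // negb_or Ps. Qed.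
Let nP0 s : s \notin P -> s != 0.
Proof. by apply: contraNneq => ->; apply: prime0. Qed.

Lemma uniformizer_neq0 : q != 0.
Proof.
case: nzP => x Px x0; apply/eqP => q0; have [_ /(_ x Px)[s [t [Ps]]]] := unifq.
rewrite q0 mulr0; apply/eqP; apply: dom_mulf_neq0 => //.
exact: nP0.
Qed.

Let qX_neq0 m : q ^+ m != 0.
Proof.
elim: m => [|m IH]; first by rewrite expr0 oner_eq0.
by rewrite exprS dom_mulf_neq0 // uniformizer_neq0.
Qed.

Lemma in_local_powE m x :
  in_local_pow P m x <-> exists s t, s \notin P /\ s * x = t * q ^+ m.
Proof.
split=> [[s Ps [r [b [y [Py]]]]]|[s [t [Ps sx]]]]; last first.
  exists s => //; exists 1%N, (fun=> t), (fun _ _ => q); split.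
    by move=> _ _; case: unifq.
  by rewrite big_ord1 sx prodr_const card_ord.
have prodP (z : 'I_m -> A) : (forall j, z j \in P) ->
    exists s' t', s' \notin P /\ s' * \prod_(j < m) z j = t' * q ^+ m.
  elim: m {y Py} z => [|k IH] z Pz.
    by exists 1, 1; rewrite big_ord0 expr0.
  have [|s1 [t1 [Ps1 e1]]] := IH (fun j => z (fintype.lift ord0 j)) => //.
  have [_ /(_ _ (Pz ord0))[s2 [t2 [Ps2 e2]]]] := unifq.
  exists (s2 * s1), (t2 * t1); split; first exact: nPM.
  by rewrite big_ord_recl mulrACA e1 e2 exprS mulrACA.
have sumP (k : nat) (c : 'I_k -> A) (z : 'I_k -> 'I_m -> A) :
    (forall i j, z i j \in P) ->
    exists s' t', s' \notin P /\
      s' * (\sum_(i < k) c i * \prod_(j < m) z i j) = t' * q ^+ m.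
  elim: k c z => [|k IH] c z Pz.
    by exists 1, 0; rewrite big_ord0 mulr0 mul0r.
  have [|s1 [t1 [Ps1 e1]]] :=
    IH (fun i => c (fintype.lift ord0 i))
       (fun i => z (fintype.lift ord0 i)) => //.
  have [s2 [t2 [Ps2 e2]]] := prodP _ (Pz ord0).
  exists (s1 * s2), (s1 * c ord0 * t2 + s2 * t1); split; first exact: nPM.
  rewrite big_ord_recl mulrDr mulrDl -!mulrA -e1 -e2; congr (_ + _).
    by rewrite !mulrA; congr (_ * _); rewrite mulrAC.
  by rewrite mulrCA.
have [s1 [t1 [Ps1 e1]]] := sumP r b y Py.
move=> sx; exists (s1 * s), t1; split; first exact: nPM.
by rewrite -mulrA sx e1.
Qed.

Lemma local_pow_lin m a x y :
  in_local_pow P m x -> in_local_pow P m y -> in_local_pow P m (a * x + y).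
Proof.
rewrite !in_local_powE => -[s [t [Ps e]]] [s' [t' [Ps' e']]].
exists (s * s'), (s' * a * t + s * t'); split; first exact: nPM.
by rewrite mulrDl -!mulrA -e -e'; ring.
Qed.

Lemma local_pow0 m : in_local_pow P m 0.
Proof. by apply/in_local_powE; exists 1, 0; rewrite mulr0 mul0r. Qed.

Lemma local_powMl m a x : in_local_pow P m x -> in_local_pow P m (a * x).
Proof.
by move=> Lx; have := local_pow_lin a Lx (local_pow0 m); rewrite addr0.
Qed.

Lemma local_powN m x : in_local_pow P m (- x) <-> in_local_pow P m x.
Proof.
by split=> /(local_powMl (-1)); rewrite mulN1r ?opprK.
Qed.

Lemma local_pow_cancel m s x :
  s \notin P -> in_local_pow P m (s * x) -> in_local_pow P m x.
Proof.
move=> Ps /in_local_powE[s' [t [Ps' e]]]; apply/in_local_powE.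
by exists (s' * s), t; split; [exact: nPM | rewrite -mulrA].
Qed.

Lemma local_pow_anti m n x :
  (m <= n)%N -> in_local_pow P n x -> in_local_pow P m x.
Proof.
move=> mn /in_local_powE[s [t [Ps e]]]; apply/in_local_powE.
by exists s, (t * q ^+ (n - m)); rewrite -mulrA -exprD subnK.
Qed.

Lemma local_pow_0 x : in_local_pow P 0 x.
Proof. by apply/in_local_powE; exists 1, x; rewrite mul1r expr0 mulr1. Qed.

Lemma local_powM m n x y :
  in_local_pow P m x -> in_local_pow P n y -> in_local_pow P (m + n) (x * y).
Proof.
rewrite !in_local_powE => -[s [t [Ps e]]] [s' [t' [Ps' e']]].
exists (s * s'), (t * t'); split; first exact: nPM.
by rewrite mulrACA e e' exprD mulrACA.
Qed.

(** In A_P, x is a unit times q^m: if t were in P, it would yield one more factor q. Conversely,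
    cancelling q^m from an expression with q^(m+1) would put a product of two elements outside P
    into P. *)
Lemma has_ordE x m :
  has_ord P x m <->
  exists s t, [/\ s \notin P, t \notin P & s * x = t * q ^+ m].
Proof.
split=> [[/in_local_powE[s [t [Ps e]]] nL]|[s [t [Ps Pt e]]]].
  exists s, t; split=> //; apply/negP => Pt; apply: nL; apply/in_local_powE.
  have [_ /(_ t Pt)[s' [t' [Ps' e']]]] := unifq.
  exists (s' * s), t'; split; first exact: nPM.
  by rewrite -mulrA e mulrA e' exprS mulrA.
split; first by apply/in_local_powE; exists s, t.
move/in_local_powE => [s' [t' [Ps' e']]].
have /(dom_mulIf (qX_neq0 m)) E : s' * t * q ^+ m = s * t' * q * q ^+ m.
  by rewrite -!mulrA -e -exprS -e' mulrCA.
have := nPM Ps' Pt; rewrite E PM //; by case: unifq.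
Qed.

Lemma has_ordM x y m n :
  has_ord P x m -> has_ord P y n -> has_ord P (x * y) (m + n).
Proof.
move=> /has_ordE[s [t [Ps Pt e]]] /has_ordE[s' [t' [Ps' Pt' e']]].
apply/has_ordE; exists (s * s'), (t * t'); split; try exact: nPM.
by rewrite mulrACA e e' exprD mulrACA.
Qed.

(* If x had infinite order, the traces on A of the fractional ideals          *)
(* x q^-m A_P would form a strictly increasing chain.                         *)
Lemma has_ord_exists x : x != 0 -> exists m, has_ord P x m.
Proof.
move=> x0; apply: contrapT => noord.
have Lx m : in_local_pow P m x.
  elim: m => [|m IH]; first exact: local_pow_0.
  by apply: contrapT => nL; apply: noord; exists m.
pose I m (y : A) := exists s c, s \notin P /\ s * (y * q ^+ m) = c * x.
have [m|m y [s [c [Ps e]]]|N stab] := noethA (I := I).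
- split; first by exists 1, 0; rewrite !mul0r mulr0.
  move=> a y z [s [c [Ps e]]] [s' [c' [Ps' e']]].
  exists (s * s'), (s' * a * c + s * c'); split; first exact: nPM.
  transitivity (s' * a * (s * (y * q ^+ m)) + s * (s' * (z * q ^+ m))).
    by ring.
  by rewrite e e'; ring.
- exists s, (c * q); split=> //.
  by rewrite exprSr [y * _]mulrA [s * _]mulrA e mulrAC.
have /in_local_powE[s [t [Ps e]]] := Lx N.+1.
have [|s' [c [Ps' e']]] := stab N.+1 t.
  by exists 1, s; rewrite mul1r e.
have /(dom_mulIf x0) E : s' * s * x = c * q * x.
  by rewrite -mulrA e mulrAC -e' exprSr !mulrA.
by have := nPM Ps' Ps; rewrite E PM //; case: unifq.
Qed.

(** A_P is a valuation ring: the element of smaller order divides the other. *)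
Lemma local_comparable x y :
  (exists s t, s \notin P /\ s * y = t * x) \/
  (exists s t, s \notin P /\ s * x = t * y).
Proof.
have [->|x0] := eqVneq x 0; first by right; exists 1, 0; rewrite mul0r mulr0.
have [->|y0] := eqVneq y 0; first by left; exists 1, 0; rewrite mul0r mulr0.
have [m /has_ordE[s [t [Ps Pt e]]]] := has_ord_exists x0.
have [n /has_ordE[s' [t' [Ps' Pt' e']]]] := has_ord_exists y0.
have [mn|/ltnW nm] := leqP m n; [left|right].
  exists (t * s'), (t' * q ^+ (n - m) * s); split; first exact: nPM.
  by rewrite -!mulrA e e' -{1}(subnK mn) exprD; ring.
exists (t' * s), (t * q ^+ (m - n) * s'); split; first exact: nPM.
by rewrite -!mulrA e e' -{1}(subnK nm) exprD; ring.
Qed.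

Lemma ideal_ord_exists (I : A -> Prop) :
  (exists2 x, I x & x != 0) -> exists m, ideal_ord P I m.
Proof.
case=> x0 Ix0 /has_ord_exists[m0 [_ nL0]].
have ex : exists m, `[< exists2 x, I x & ~ in_local_pow P m.+1 x >].
  by exists m0; apply/asboolP; exists x0.
case: (ex_minnP ex) => m /asboolP[x Ix nLx] mmin.
exists m; split; last by exists x.
move=> y Iy; apply: contrapT => nLy; case: m => [|m] in mmin nLy {x Ix nLx}.
  by apply: nLy; apply: local_pow_0.
have /mmin : `[< exists2 x, I x & ~ in_local_pow P m.+1 x >].
  by apply/asboolP; exists y.
by rewrite ltnn.
Qed.

Lemma ideal_ord_uniq (I : A -> Prop) m n :
  ideal_ord P I m -> ideal_ord P I n -> m = n.
Proof.
suff le k l : ideal_ord P I k -> ideal_ord P I l -> (k <= l)%N.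
  by move=> Im In; apply/eqP; rewrite eqn_leq !le.
move=> [Ik _] [_ [x Ix nL]]; rewrite leqNgt; apply/negP => lk.
exact/nL/local_pow_anti/Ik.
Qed.

Lemma ideal_ord_principal x m :
  has_ord P x m -> ideal_ord P (fun z => exists a, z = a * x) m.
Proof.
case=> Lx nLx; split; last by exists x => //; exists 1; rewrite mul1r.
by move=> _ [a ->]; apply: local_powMl.
Qed.

Lemma ideal_ord_scale (I J : A -> Prop) (x y : A) mx my m n :
  has_ord P x mx -> has_ord P y my ->
  (forall z, (exists2 w, I w & z = x * w) <-> (exists2 w, J w & z = y * w)) ->
  ideal_ord P I m -> ideal_ord P J n -> (mx + m = my + n)%N.
Proof.
move=> ox oy IJ oI oJ.
have scale K z k l : has_ord P z k -> ideal_ord P K l ->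
    ideal_ord P (fun u => exists2 w, K w & u = z * w) (k + l).
  move=> oz [KL [w Kw nLw]]; split.
    by move=> _ [v Kv ->]; apply: local_powM; [case: oz | apply: KL].
  exists (z * w); first by exists w.
  have /has_ordM/(_ oz) : has_ord P w l by split=> //; apply: KL.
  by rewrite addnC mulrC => -[].
apply: ideal_ord_uniq (scale _ _ _ _ ox oI) _.
have -> : (fun u => exists2 w, I w & u = x * w) =
          (fun u => exists2 w, J w & u = y * w).
  by apply/funext => u; apply/propext.
exact: scale.
Qed.

(** Row reduction over the valuation ring A_P: one of the second coordinates divides the other, so
    up to a unit each determinant is that of a triangular matrix, with one diagonal entry in the
    ideal of all a with (a, 0) in N and the other in the second projection of N. Elements of least
    order in these two ideals attain m + n. *)
Lemma det_ord (N : A -> A -> Prop) m n :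
  (forall a x1 x2 y1 y2, N x1 x2 -> N y1 y2 ->
     N (a * x1 + y1) (a * x2 + y2)) ->
  N 0 0 ->
  ideal_ord P (fun a => N a 0) m ->
  ideal_ord P (fun b => exists a, N a b) n ->
  ideal_ord P (fun d => exists x1 x2 y1 y2,
    [/\ N x1 x2, N y1 y2 & d = x1 * y2 - x2 * y1]) (m + n).
Proof.
move=> Nlin N0 [Lm [a Na nLa]] [Ln [c [b Nbc] nLc]]; split; last first.
  exists (a * c); first by exists a, 0, b, c; rewrite mul0r subr0.
  have oa : has_ord P a m by split=> //; apply: Lm.
  have oc : has_ord P c n by split=> //; apply: Ln; exists b.
  by case: (has_ordM oa oc).
have key x1 x2 y1 y2 s t : N x1 x2 -> N y1 y2 -> s \notin P ->
    s * y2 = t * x2 -> in_local_pow P (m + n) (x1 * y2 - x2 * y1).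
  move=> Nx Ny Ps e; apply: (local_pow_cancel Ps).
  have -> : s * (x1 * y2 - x2 * y1) = - ((s * y1 - t * x1) * x2).
    have -> : s * (x1 * y2 - x2 * y1) = x1 * (s * y2) - s * (x2 * y1) by ring.
    by rewrite e; ring.
  apply/local_powN/local_powM; last by apply: Ln; exists x1.
  apply: Lm.
  have := Nlin (- t) x1 x2 (s * y1 + 0) (s * y2 + 0) Nx (Nlin s _ _ _ _ Ny N0).
  have -> : - t * x1 + (s * y1 + 0) = s * y1 - t * x1 by ring.
  by have -> : - t * x2 + (s * y2 + 0) = 0 by rewrite e; ring.
move=> _ [x1 [x2 [y1 [y2 [Nx Ny ->]]]]].
have [[s [t [Ps e]]]|[s [t [Ps e]]]] := local_comparable x2 y2.
  exact: key e.
have -> : x1 * y2 - x2 * y1 = - (y1 * x2 - y2 * x1) by ring.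
exact/local_powN/(key _ _ _ _ _ _ Ny Nx Ps e).
Qed.

(* Both sides are the order of the ideal of 2 x 2 determinants of N.          *)
Lemma goursat_ord (N : A -> A -> Prop) m1 n1 m2 n2 :
  (forall a x1 x2 y1 y2, N x1 x2 -> N y1 y2 ->
     N (a * x1 + y1) (a * x2 + y2)) ->
  N 0 0 ->
  ideal_ord P (fun a => N a 0) m1 ->
  ideal_ord P (fun a => exists b, N a b) n1 ->
  ideal_ord P (fun b => N 0 b) m2 ->
  ideal_ord P (fun b => exists a, N a b) n2 ->
  (m1 + n2 = m2 + n1)%N.
Proof.
move=> Nlin N0 o1 o1' o2 o2'.
apply: ideal_ord_uniq (det_ord Nlin N0 o1 o2') _.
have := @det_ord (fun x y => N y x) m2 n1.
have -> : (fun d => exists x1 x2 y1 y2,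
    [/\ N x1 x2, N y1 y2 & d = x1 * y2 - x2 * y1]) =
  (fun d => exists x1 x2 y1 y2,
    [/\ N x2 x1, N y2 y1 & d = x1 * y2 - x2 * y1]).
  apply/funext => d; apply/propext.
  by split=> -[x1 [x2 [y1 [y2 [Nx Ny ->]]]]]; exists y2, y1, x2, x1;
    split=> //; ring.
apply=> //.
by move=> a x1 x2 y1 y2; apply: Nlin.
Qed.

End OnePrime.

End LocalOrders.

(** * Invariants of finitely generated modules *)

Section FreeQuotients.

Lemma zquot_lift (V H : zmodType) (S : V -> Prop) (f : {additive V -> H}) :
  (forall y, S y -> f y = 0) ->
  exists phi : {additive Quotient.quot (zspan S) -> H},
    forall x, phi (\pi x) = f x.
Proof.
move=> fS; pose phi (q : Quotient.quot (zspan S)) : H := f (repr q).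
have phiE x : phi (\pi x) = f x.
  apply/eqP; rewrite -subr_eq0 -raddfB; apply/eqP.
  have : repr (\pi_(Quotient.quot (zspan S)) x) - x \in zspan S.
    by rewrite Quotient.idealrBE reprK.
  move/asboolP/(_ (fun y => f y == 0)) => h.
  apply/eqP/h => [|y Sy]; last by apply/eqP/fS.
  split=> [|y z]; first by rewrite unfold_in raddf0.
  by rewrite !unfold_in raddfB => /eqP -> /eqP ->; rewrite subrr.
have phiB : zmod_morphism phi.
  move=> x y; rewrite -[x]reprK -[y]reprK.
  rewrite -(raddfB (\pi_(Quotient.quot (zspan S)))) !phiE.
  exact: raddfB.
pose phiM := GRing.isZmodMorphism.Build _ _ phi phiB.
by exists (HB.pack_for {additive Quotient.quot (zspan S) -> H} phi phiM).
Qed.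

Lemma freeg_additive_eq (K : choiceType) (H : zmodType)
    (f g : {additive {freeg K} -> H}) :
  (forall k, f << k >> = g << k >>) -> f =1 g.
Proof.
move=> fg D; rewrite -(freeg_sumE D) !raddf_sum; apply: eq_bigr => k _.
by rewrite -[coeff k D]intz -freegU_mulz !raddfMz /= fg.
Qed.

Lemma freeg_lift (K : choiceType) (H : zmodType) (f : K -> H) :
  exists phi : {additive {freeg K} -> H}, forall k, phi << k >> = f k.
Proof.
pose F (D : {freeg K}) : H := fglift (f : K -> zmodule H) D.
have FB : zmod_morphism F by exact: (lift_is_additive (M := zmodule H) f).
pose FM := GRing.isZmodMorphism.Build _ _ F FB.
exists (HB.pack_for {additive {freeg K} -> H} F FM) => k.
by rewrite /= /F liftU scale1r.
Qed.

End FreeQuotients.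

Section ColonSums.
Variables (A : comNzRingType) (H : zmodType) (e : (A -> Prop) -> H).

(** The sum of [e] over the annihilators of the successive cyclic quotients of the filtration of V /
    W generated by the elements of [g] in order. *)
Fixpoint colon_sum (V : lmodType A) (W : V -> Prop) (g : seq V) : H :=
  if g is x :: g' then e (colon W x) + colon_sum (adjoin W x) g' else 0.

Definition span_over (V : lmodType A) (W : V -> Prop) (g : seq V) : V -> Prop :=
  foldl (@adjoin A V) W g.

Section Span.
Variable V : lmodType A.
Implicit Types (W : V -> Prop) (g h : seq V).

Lemma span_submod W g : is_submod W -> is_submod (span_over W g).
Proof.
by elim: g W => [|x g IH] W subW //=; apply: IH; apply: adjoin_submod.
Qed.

Lemma sub_span W g x : W x -> span_over W g x.
Proof. by elim: g W => [|y g IH] W Wx //=; apply: IH; apply: sub_adjoin. Qed.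

Lemma mem_span W g x : is_submod W -> x \in g -> span_over W g x.
Proof.
elim: g W => [|y g IH] W subW //=; rewrite inE => /orP[/eqP ->|xg].
  by apply: sub_span; apply: mem_adjoin.
by apply: IH => //; apply: adjoin_submod.
Qed.

Lemma span_min W W' g : is_submod W' -> (forall x, W x -> W' x) ->
  (forall x, x \in g -> W' x) -> forall x, span_over W g x -> W' x.
Proof.
move=> subW'; elim: g W => [|y g IH] W WW' gW' x /=; first exact: WW'.
apply: IH => [z [a /WW' h]|z zg]; last by apply: gW'; rewrite inE zg orbT.
rewrite -[z](subrK (a *: y)); apply: submodD => //; apply: submodZ => //.
by apply: gW'; rewrite mem_head.
Qed.

Lemma colon_sum_cat W g h :
  colon_sum W (g ++ h) = colon_sum W g + colon_sum (span_over W g) h.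
Proof.
elim: g W => [|x g IH] W /=; first by rewrite add0r.
by rewrite IH addrA.
Qed.

End Span.

Lemma colon_sum_map (U V : lmodType A) (f : {linear U -> V}) (W : V -> Prop) g :
  colon_sum (fun x => W (f x)) g = colon_sum W [seq f x | x <- g].
Proof.
elim: g W => [|x g IH] W //=; rewrite -IH; congr (_ + _).
  by congr e; apply/funext => a; rewrite /colon linearZ.
congr colon_sum; apply/funext => y; apply/propext.
by split=> -[a h]; exists a; move: h; rewrite /= ?linearB ?linearZ.
Qed.

Lemma span_map (U V : lmodType A) (f : {linear U -> V}) (W : V -> Prop) g :
  span_over (fun x => W (f x)) g =
  (fun x => span_over W [seq f x | x <- g] (f x)).
Proof.
elim: g W => [|x g IH] W //=; rewrite -IH; congr span_over.
apply/funext => y; apply/propext.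
by split=> -[a h]; exists a; move: h; rewrite /= ?linearB ?linearZ.
Qed.

Hypothesis e_full : e (fun=> True) = 0.
(** For a submodule N of A^2, the sides are the values of [colon_sum] on A^2 / N for the two orders
    of the standard generators. *)
Hypothesis e_goursat : forall N : A -> A -> Prop, N 0 0 ->
  (forall a x1 x2 y1 y2, N x1 x2 -> N y1 y2 ->
     N (a * x1 + y1) (a * x2 + y2)) ->
  e (fun a => N a 0) + e (fun b => exists a, N a b) =
  e (fun b => N 0 b) + e (fun a => exists b, N a b).

Section Invariance.
Variable V : lmodType A.
Implicit Types (W : V -> Prop) (g h : seq V).

Lemma colon_sum_swap W x y g : is_submod W ->
  colon_sum W (x :: y :: g) = colon_sum W (y :: x :: g).
Proof.
move=> subW /=; rewrite adjoinC !addrA; congr (_ + _).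
have [W0 Wlin] := subW; pose N a b := W (a *: x + b *: y).
have N0 : N 0 0 by rewrite /N !scale0r addr0.
have Nlin a x1 x2 y1 y2 : N x1 x2 -> N y1 y2 -> N (a * x1 + y1) (a * x2 + y2).
  move=> Wx Wy; have := Wlin a _ _ Wx Wy.
  by rewrite scalerDr !scalerA addrACA -!scalerDl.
have := e_goursat N0 Nlin.
have -> : (fun a => N a 0) = colon W x.
  by apply/funext => a; rewrite /N scale0r addr0.
have -> : (fun b => N 0 b) = colon W y.
  by apply/funext => a; rewrite /N scale0r add0r.
have -> : (fun b => exists a, N a b) = colon (adjoin W x) y.
  apply/funext => a; apply/propext.
  by split=> -[b Wb]; exists (- b); move: Wb; rewrite /N addrC scaleNr ?opprK.
have -> // : (fun a => exists b, N a b) = colon (adjoin W y) x.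
apply/funext => a; apply/propext.
by split=> -[b Wb]; exists (- b); move: Wb; rewrite /N scaleNr ?opprK.
Qed.

Lemma colon_sum_shift W x g h : is_submod W ->
  colon_sum W (x :: g ++ h) = colon_sum W (g ++ x :: h).
Proof.
elim: g W => [|y g IH] W subW //.
rewrite [_ ++ _]/= colon_sum_swap //= -IH //.
exact: adjoin_submod.
Qed.

Lemma colon_sum_catC W g h : is_submod W ->
  colon_sum W (g ++ h) = colon_sum W (h ++ g).
Proof.
elim: g W => [|x g IH] W subW; first by rewrite cats0.
by rewrite -colon_sum_shift //= IH //; apply: adjoin_submod.
Qed.

Lemma colon_sum_absorb W g : is_submod W -> (forall x, x \in g -> W x) ->
  colon_sum W g = 0.
Proof.
move=> subW; elim: g => //= x g IH gW.
have Wx : W x by apply: gW; rewrite mem_head.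
rewrite colon_full // e_full add0r adjoin_id // IH // => y yg.
by apply: gW; rewrite inE yg orbT.
Qed.

(** Appending [h] to the generating list [g] adds only values on the unit ideal, and likewise with
    [g] and [h] exchanged; the two concatenations differ by a permutation. *)
Lemma colon_sum_indep W g h : is_submod W ->
  (forall x, span_over W g x) -> (forall x, span_over W h x) ->
  colon_sum W g = colon_sum W h.
Proof.
move=> subW gV hV; have := colon_sum_catC g h subW.
rewrite !colon_sum_cat (colon_sum_absorb (span_submod g subW)) //.
by rewrite (colon_sum_absorb (span_submod h subW)) // !addr0.
Qed.

End Invariance.

Definition fg_gens (M : fgmod A) : seq M :=
  [seq quotmod_pi (fg_relsP M) (delta_mx 0 i) | i <- enum 'I_(fg_rank M)].

Definition fg_invariant (M : fgmod A) : H :=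
  colon_sum (fun x : M => x = 0) (fg_gens M).

Lemma fg_gens_span (M : fgmod A) (x : M) :
  span_over (fun x => x = 0) (fg_gens M) x.
Proof.
have [y <-] := quotmod_pi_surj x; rewrite (row_sum_delta y) linear_sum.
have subS := span_submod (fg_gens M) (zero_submod M).
elim/big_ind: _ => [|u v|i _]; [by case: subS | exact: submodD|].
rewrite linearZ; apply: submodZ => //.
apply: mem_span; first exact: zero_submod.
by apply/mapP; exists i; rewrite ?mem_enum.
Qed.

Lemma fg_invariant_rels (M : fgmod A) :
  fg_invariant M = colon_sum (fun x => fg_rels x)
    [seq delta_mx 0 i | i <- enum 'I_(fg_rank M)].
Proof.
rewrite /fg_invariant /fg_gens.
rewrite (map_comp (quotmod_pi (fg_relsP M)) (fun i => delta_mx 0 i)).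
rewrite -(colon_sum_map (quotmod_pi (fg_relsP M))); congr colon_sum.
apply/funext => x; apply/propext.
rewrite -(raddf0 (quotmod_pi (fg_relsP M))); split.
  by move/quotmod_piP; rewrite subr0.
by move=> h; apply/quotmod_piP; rewrite subr0.
Qed.

(** By independence of the generators, M may be generated by the images of the generators of M'
    followed by lifts of those of M''. The first part of the sum is then the invariant of M', the
    second that of M''. *)
Lemma fg_invariant_ses (M' M M'' : fgmod A) (i : {linear M' -> M})
    (p : {linear M -> M''}) :
  short_exact i p -> fg_invariant M = fg_invariant M' + fg_invariant M''.
Proof.
case=> i_inj p_surj p_ker.
pose lft (z : M'') : M := sval (cid (p_surj z)).
have lftK z : p (lft z) = z by rewrite /lft; case: cid.
pose g' := [seq i x | x <- fg_gens M'].
pose l := [seq lft z | z <- fg_gens M''].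
have sub0 := zero_submod M.
have i0 : (fun x => i x = 0) = (fun x => x = 0).
  apply/funext => x; apply/propext; split=> [|->]; last exact: raddf0.
  by rewrite -(raddf0 i) => /i_inj.
have pl : [seq p x | x <- l] = fg_gens M''.
  by rewrite -map_comp -[RHS]map_id; apply: eq_map => z /=; apply: lftK.
have spang' : span_over (fun x => x = 0) g' = (fun y => p y = 0).
  apply/funext => y; apply/propext; split.
    apply: (@span_min _ (fun x => x = 0) (fun y => p y = 0))
      => [|x ->|_ /mapP[x _ ->]].
    - split; first exact: raddf0.
      by move=> a u v pu pv; rewrite linearP pu pv scaler0 addr0.
    - exact: raddf0.
    - by apply/p_ker; exists x.
  move/p_ker => [x <-].
  have := span_map i (fun y => y = 0) (fg_gens M').
  by rewrite i0 => /(congr1 (@^~ x)) <-; apply: fg_gens_span.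
rewrite /fg_invariant (@colon_sum_indep _ _ (fg_gens M) (g' ++ l)) //.
- rewrite colon_sum_cat spang' (colon_sum_map p (fun x => x = 0)) pl.
  by rewrite -(colon_sum_map i) i0.
- exact: fg_gens_span.
- move=> y; rewrite /span_over foldl_cat -!/(span_over _ _) spang'.
  by rewrite (span_map p (fun x => x = 0)) pl; apply: fg_gens_span.
Qed.

Lemma G0_invariant : exists phi : {additive G0 A -> H},
  forall M, phi (\pi << M >>) = fg_invariant M.
Proof.
have [f fE] := freeg_lift fg_invariant.
have [y|phi phiE] := @zquot_lift _ _ (@ses_relation A) f.
  case=> M' [M [M'' [i [p [ex ->]]]]].
  by rewrite !raddfB /= !fE (fg_invariant_ses ex) addrAC addrK subrr.
by exists phi => M; rewrite phiE fE.
Qed.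

End ColonSums.

(** * Classes of cyclic modules *)

Section Classes.
Variable A : comNzRingType.

Lemma quotmod_lift (V U : lmodType A) (N : {pred V}) (Nc : submod_closed N)
    (f : {linear V -> U}) :
  (forall x, x \in N -> f x = 0) ->
  exists g : {linear quotmod Nc -> U}, forall x, g (quotmod_pi Nc x) = f x.
Proof.
move=> fN.
have secP (q : quotmod Nc) : {x | quotmod_pi Nc x = q}.
  exact: cid (quotmod_pi_surj q).
pose g q := f (sval (secP q)).
have gE x : g (quotmod_pi Nc x) = f x.
  rewrite /g; case: (secP _) => y /= /quotmod_piP /fN /eqP.
  by rewrite raddfB subr_eq0 => /eqP.
have gL : linear g.
  move=> c x y; have [u <-] := quotmod_pi_surj x.
  by have [v <-] := quotmod_pi_surj y; rewrite -linearP !gE linearP.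
pose gM := GRing.isLinear.Build _ _ _ _ g gL.
by exists (HB.pack_for {linear quotmod Nc -> U} g gM).
Qed.

Lemma submod_closed_asbool (V : lmodType A) (W : V -> Prop) :
  is_submod W -> submod_closed (fun x => `[< W x >]).
Proof.
case=> W0 Wlin; split; first exact/asboolP.
by move=> a x y /asboolP Wx /asboolP Wy; apply/asboolP/Wlin.
Qed.

Definition quot_fg k (W : 'rV[A]_k -> Prop) (subW : is_submod W) : fgmod A :=
  FgMod (submod_closed_asbool subW).

Definition G0_class (M : fgmod A) : G0 A := \pi << M >>.

Lemma G0_class_ses (M' M M'' : fgmod A) (i : {linear M' -> M})
    (p : {linear M -> M''}) :
  short_exact i p -> G0_class M = G0_class M' + G0_class M''.
Proof.
move=> ex; apply/eqP; rewrite -subr_eq0 opprD addrA -!raddfB.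
rewrite -(raddf0 \pi_(Quotient.quot (zspan (@ses_relation A)))).
rewrite -Quotient.idealrBE subr0; apply/asboolP => N _; apply.
by exists M', M, M'', i, p.
Qed.

Lemma quot_fg_rels (M : fgmod A) (subM : is_submod (fun x => @fg_rels A M x)) :
  quot_fg subM = M.
Proof.
case: M subM => k N Nc subM; rewrite /quot_fg.
move: (submod_closed_asbool _) => /=.
have -> : (fun x : 'rV_k => `[< N x >]) = N.
  by apply/funext => x; apply: asboolb.
by move=> Nc'; rewrite (Prop_irrelevance Nc Nc').
Qed.

(** For M = 0 the identity maps form an exact sequence 0 -> M -> M -> M -> 0, whence [M] = [M] +
    [M]. *)
Lemma G0_class_full k (W : 'rV[A]_k -> Prop) (subW : is_submod W) :
  (forall x, W x) -> G0_class (quot_fg subW) = 0.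
Proof.
move=> Wfull; pose M := quot_fg subW.
have M0 (x : M) : x = 0.
  have [y <-] := quotmod_pi_surj x.
  rewrite -(raddf0 (quotmod_pi (fg_relsP M))); apply/quotmod_piP.
  exact/asboolP.
apply: (addrI (G0_class M)); rewrite addr0; symmetry.
apply: (@G0_class_ses M M M idfun idfun); split=> //= [z|y]; first by exists z.
by split=> _; [exists y | exact: M0].
Qed.

Lemma row_ideal_submod (I : A -> Prop) :
  is_ideal I -> is_submod (fun r : 'rV[A]_1 => I (r 0 0)).
Proof.
case=> I0 Ilin; split; first by rewrite mxE.
by move=> a x y Ix Iy; rewrite !mxE; apply: Ilin.
Qed.

(** From the exact sequence of A / (W : x), A^k / W and A^k / (W + A x), whose first map sends 1 to
    the class of x. *)
Lemma G0_class_adjoin k (W : 'rV[A]_k -> Prop) (x : 'rV[A]_k)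
    (subW : is_submod W) :
  G0_class (quot_fg subW) =
  G0_class (quot_fg (row_ideal_submod (colon_ideal subW x))) +
  G0_class (quot_fg (adjoin_submod subW x)).
Proof.
set M := quot_fg subW; set M' := quot_fg _; set M'' := quot_fg _.
have piM y z : quotmod_pi (fg_relsP M) y = quotmod_pi (fg_relsP M) z <->
  W (y - z) by split=> [/quotmod_piP/asboolP|h]; last exact/quotmod_piP/asboolP.
pose f (r : 'rV[A]_1) : M := quotmod_pi (fg_relsP M) (r 0 0 *: x).
have fL : linear f.
  by move=> a r s; rewrite /f !mxE scalerDl -scalerA linearP.
pose fM := GRing.isLinear.Build _ _ _ _ f fL.
have [r|i iE] := @quotmod_lift _ _ _ (fg_relsP M')
    (HB.pack_for {linear 'rV[A]_1 -> M} f fM).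
  move=> /asboolP Wr; rewrite /= /f -(raddf0 (quotmod_pi (fg_relsP M))).
  by apply/piM; rewrite subr0.
pose pi'' : {linear 'rV[A]_k -> M''} := quotmod_pi (fg_relsP M'').
have [y|p pE] := @quotmod_lift _ _ _ (fg_relsP M) pi''.
  move=> /asboolP Wy; rewrite -(raddf0 pi''); apply/quotmod_piP/asboolP.
  by rewrite subr0; apply: sub_adjoin.
apply: (@G0_class_ses M' M M'' i p); split=> [q1 q2|z|y].
- have [r <-] := quotmod_pi_surj q1; have [s <-] := quotmod_pi_surj q2.
  rewrite !iE /= /f => /piM; rewrite -scalerBl => h.
  by apply/quotmod_piP/asboolP; rewrite !mxE.
- have [y <-] := quotmod_pi_surj z.
  by exists (quotmod_pi (fg_relsP M) y); rewrite pE.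
have [w <-] := quotmod_pi_surj y; rewrite pE -(raddf0 pi''); split.
  move=> /quotmod_piP/asboolP; rewrite subr0 => -[a Wa].
  exists (quotmod_pi (fg_relsP M') (a%:M)); rewrite iE /= /f mxE eqxx mulr1n.
  by apply/piM; rewrite -opprB -scaleN1r; apply: submodZ.
case=> q; have [r <-] := quotmod_pi_surj q; rewrite iE /= /f => /piM h.
apply/quotmod_piP/asboolP; rewrite subr0; exists (r 0 0).
by rewrite -opprB -scaleN1r; apply: submodZ.
Qed.

(* Junk value 0 when I is not an ideal.                                       *)
Definition cyclic_class (I : A -> Prop) : G0 A :=
  if pselect (is_ideal I) is left idI
  then G0_class (quot_fg (row_ideal_submod idI)) else 0.

Lemma cyclic_classE (I : A -> Prop) (idI : is_ideal I) :
  cyclic_class I = G0_class (quot_fg (row_ideal_submod idI)).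
Proof.
rewrite /cyclic_class; case: pselect => // idI'.
by rewrite (Prop_irrelevance idI idI').
Qed.

Lemma G0_class_colon_sum k (W : 'rV[A]_k -> Prop) (subW : is_submod W) g :
  (forall x, span_over W g x) ->
  G0_class (quot_fg subW) = colon_sum cyclic_class W g.
Proof.
elim: g W subW => [|x g IH] W subW /= spanW; first exact: G0_class_full.
by rewrite (G0_class_adjoin x) (IH _ _ spanW) -cyclic_classE.
Qed.

(** Since [cyclic_class] is itself a function of ideals, this expresses [M] by cyclic modules; it
    reduces the verification of the inverse to those. *)
Lemma G0_class_fg (M : fgmod A) : G0_class M = fg_invariant cyclic_class M.
Proof.
have subM : is_submod (fun x => @fg_rels A M x).
  case: (fg_relsP M) => M0 Mlin; split=> // a x y; exact: Mlin.
rewrite fg_invariant_rels -{1}(quot_fg_rels subM).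
apply: (G0_class_colon_sum subM (g := [seq delta_mx 0 i | i <- enum _])) => x.
rewrite (row_sum_delta x).
set g := map _ _; have subS := span_submod g subM.
elim/big_ind: _ => [|u v|i _]; [by case: subS | exact: submodD|].
apply: submodZ => //; apply: mem_span => //.
by apply/mapP; exists i; rewrite ?mem_enum.
Qed.

Lemma cyclic_class_full : cyclic_class (fun=> True) = 0.
Proof.
have idT : is_ideal (fun _ : A => True) by [].
by rewrite (cyclic_classE idT); apply: G0_class_full.
Qed.

Lemma cyclic_class_split (I : A -> Prop) (y : A) : is_ideal I ->
  cyclic_class I =
  cyclic_class (colon (I : A^o -> Prop) y) +
  cyclic_class (adjoin (I : A^o -> Prop) y).
Proof.
move=> idI; have subI : is_submod (I : A^o -> Prop) by [].
rewrite (cyclic_classE idI) (G0_class_adjoin (y%:M)).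
have idc := colon_ideal subI (y : A^o).
have ida : is_ideal (adjoin (I : A^o -> Prop) y) :=
  adjoin_submod subI (y : A^o).
rewrite -cyclic_classE (cyclic_classE ida).
congr (cyclic_class _ + _).
  apply/funext => a; rewrite /colon !mxE eqxx mulr1n //.
have same (W W' : 'rV[A]_1 -> Prop) (sW : is_submod W) (sW' : is_submod W') :
    W = W' -> G0_class (quot_fg sW) = G0_class (quot_fg sW').
  by move=> WW'; rewrite -WW' in sW' *; rewrite (Prop_irrelevance sW sW').
apply: same; apply/funext => r; apply/propext.
by split=> -[a h]; exists a; move: h; rewrite !mxE eqxx mulr1n.
Qed.

Lemma G0_class_additive_eq (H : zmodType) (f g : {additive G0 A -> H}) :
  (forall M, f (G0_class M) = g (G0_class M)) -> f =1 g.
Proof.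
move=> fg x; rewrite -[x]reprK.
pose q : {additive {freeg fgmod A} -> G0 A} :=
  \pi_(Quotient.quot (zspan (@ses_relation A))).
by apply: (@freeg_additive_eq _ _ (f \o q) (g \o q)) => M; apply: fg.
Qed.

End Classes.

(** * Primes of height one *)

Definition nonzero_ideal (A : comNzRingType) (I : A -> Prop) : Prop :=
  exists2 x, I x & x != 0.

Section HeightOne.
Variable A : comNzRingType.
Hypothesis domA : forall x y : A, x * y = 0 -> x = 0 \/ y = 0.
Hypothesis noethA : noetherian A.

Lemma zero_prime : prime_ideal (pred1 (0 : A)).
Proof.
split; first split.
- by rewrite inE.
- by rewrite inE oner_eq0.
- by move=> a x y; rewrite !inE => /eqP -> /eqP ->; rewrite mulr0 addr0.
- by move=> x y; rewrite !inE => /eqP /domA[] ->; rewrite eqxx ?orbT.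
Qed.

Lemma prime_is_ideal (P : {pred A}) :
  prime_ideal P -> is_ideal (fun x => x \in P).
Proof. by case=> -[P0 _ Plin] _; split=> // a x y; apply: Plin. Qed.

Lemma height1_nonzero (P : {pred A}) :
  has_height P 1 -> nonzero_ideal (fun x => x \in P).
Proof.
move=> -[[c [cP cS] cE] _].
have [_ /asboolP] := cS ord0 ord_max isT.
rewrite asbool_neg => /existsp_asboolPn[x] /asboolP.
rewrite asbool_neg => /asboolP.
move=> /not_implyP[cx n0x]; exists x; first by rewrite -cE.
apply/eqP => x0; apply: n0x; rewrite x0.
by have [[]] := cP ord0.
Qed.

Lemma height1_min (P Q : {pred A}) : has_height P 1 -> prime_ideal Q ->
  nonzero_ideal (fun x => x \in Q) -> {subset Q <= P} -> {subset P <= Q}.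
Proof.
move=> htP primeQ [y Qy y0] QP; apply: contrapT => nPQ.
have primeP : prime_ideal P.
  case: htP => -[c [cP _] cE] _; have := cP ord_max.
  by have -> : c ord_max = P by apply/funext => x; apply: cE.
pose c (i : 'I_3) : {pred A} :=
  if i == 0 :> nat then (pred1 0 : {pred A})
  else if i == 1 :> nat then Q else P.
case: htP => _ /(_ 2 c); suff h : prime_chain c by move=> /(_ h (frefl _)).
have P0 : 0 \in P by case: primeP => -[].
have Q0 : 0 \in Q by case: primeQ => -[].
split=> [[[|[|i]] ilt]|[[|[|[|i]]] ilt] [[|[|[|j]]] jlt]] //=.
- exact: zero_prime.
- move=> _; split=> [x|/(_ y Qy)]; rewrite inE; last exact/negP.
  by move/eqP->.
- move=> _; split=> [x|/(_ y (QP _ Qy))]; rewrite inE; last exact/negP.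
  by move/eqP->.
Qed.

(** A nonzero prime Q inside P contains q: a nonzero x in Q satisfies s x = t q^m with t outside P,
    hence outside Q. Then Q contains all of P, as P is generated locally by q. *)
Lemma uniformizer_height1 (P : {pred A}) q : prime_ideal P ->
  nonzero_ideal (fun x => x \in P) -> local_uniformizer P q -> has_height P 1.
Proof.
move=> primeP nzP uq; have [z0 Pz0 z00] := nzP.
have P0 : 0 \in P by case: primeP => -[].
have minP (Q : {pred A}) : prime_ideal Q ->
    nonzero_ideal (fun x => x \in Q) -> {subset Q <= P} -> {subset P <= Q}.
  move=> [[Q0 Q1 Qlin] Qprime] [x Qx x0] QP.
  have QM a z : z \in Q -> a * z \in Q.
    by move=> Qz; have := Qlin a _ _ Qz Q0; rewrite addr0.
  have [m /(has_ordE domA primeP uq nzP)[s [t [Ps Pt e]]]] :=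
    has_ord_exists domA noethA primeP uq x0.
  have Qq : q \in Q.
    have /Qprime/orP[/QP|] : t * q ^+ m \in Q by rewrite -e QM.
      by rewrite (negPf Pt).
    elim: m {e} => [|m IH]; first by rewrite expr0 (negPf Q1).
    by rewrite exprS => /Qprime/orP[|/IH].
  move=> y Py; have [_ /(_ y Py)[s' [t' [Ps' e']]]] := uq.
  have /Qprime/orP[/QP|//] : s' * y \in Q by rewrite e' QM.
  by rewrite (negPf Ps').
split.
  exists (fun i : 'I_2 => if i == 0 :> nat then (pred1 0 : {pred A}) else P)
    => //=.
  split=> [[[|i] ilt]|[[|[|i]] ilt] [[|[|j]] jlt]] //=.
    exact: zero_prime.
  move=> _; split=> [x|/(_ z0 Pz0)]; rewrite inE; last exact/negP.
  by move/eqP->.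
move=> [//|[//|e]] c [cP cS] cE; exfalso.
pose i1 : 'I_e.+3 := inord 1.
have i1E : i1 = 1%N :> nat by rewrite /i1 inordK.
have [|sub1 nsub1] := cS i1 ord_max; first by rewrite i1E.
have [|sub0 nsub0] := cS ord0 i1; first by rewrite i1E.
apply: nsub1 => y; rewrite cE => Py; apply: (minP (c i1)) Py => //.
  apply: contrapT => nz; apply: nsub0 => z cz.
  have [->|nz_z] := eqVneq z 0; first by have [[]] := cP ord0.
  by case: nz; exists z.
by move=> z /sub1; rewrite cE.
Qed.

Lemma height1_prime_eq (p p' : height1_prime A) :
  (forall x, (x \in (p : {pred A})) = (x \in (p' : {pred A}))) -> p = p'.
Proof.
case: p p' => [P pP hP] [P' pP' hP'] /= /funext e.
have {}e : P = P' by exact: e.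
rewrite -e in pP' hP' *.
by rewrite (Prop_irrelevance pP pP') (Prop_irrelevance hP hP').
Qed.

Lemma height1_sub_eq (p p' : height1_prime A) :
  {subset (p : {pred A}) <= (p' : {pred A})} -> p = p'.
Proof.
move=> pp'; apply: height1_prime_eq => x; apply/idP/idP; first exact: pp'.
apply: (height1_min (h1_height p') (h1_prime p) _ pp').
exact: height1_nonzero (h1_height p).
Qed.

Lemma height1_above (Q : {pred A}) (p : height1_prime A) : prime_ideal Q ->
  nonzero_ideal (fun x => x \in Q) -> {subset Q <= (p : {pred A})} ->
  Q = p :> {pred A}.
Proof.
move=> primeQ nzQ Qp; apply/funext => x; apply/idP/idP; first exact: Qp.
exact: (height1_min (h1_height p) primeQ nzQ Qp).
Qed.

Lemma ideal_prime_or_split (I : A -> Prop) : is_ideal I ->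
  [\/ I 1, exists2 P : {pred A}, prime_ideal P & I = (fun x => x \in P)
    | exists x y, [/\ I (x * y), ~ I x & ~ I y]].
Proof.
move=> [I0 Ilin]; have [I1|nI1] := pselect (I 1); first by constructor 1.
have [sp|nsp] := pselect (exists x y, [/\ I (x * y), ~ I x & ~ I y]).
  by constructor 3.
constructor 2; exists (fun x => `[< I x >]); last first.
  by apply/funext => x; apply/propext; split=> /asboolP.
split; first split.
- exact/asboolP.
- by apply/negP => /asboolP.
- by move=> a x y /asboolP Ix /asboolP Iy; apply/asboolP/Ilin.
move=> x y /asboolP Ixy; apply: contrapT => /negP; rewrite negb_or.
move=> /andP[/asboolP nx /asboolP ny].
by apply: nsp; exists x, y.
Qed.

(** Noetherian induction. If x y is in I, a prime over I lies over I + A x or I + A y; if I is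
    itself a nonzero prime, the only prime of height one that can lie over I is I. *)
Lemma height1_over_finite (I : A -> Prop) : is_ideal I -> nonzero_ideal I ->
  exists s : seq (height1_prime A),
    forall p : height1_prime A, (forall x, I x -> x \in (p : {pred A})) ->
      p \in s.
Proof.
move=> idI; move: I idI; apply: (noetherian_ind noethA) => I idI IH nzI.
have [I1|[P primeP IP]|[x [y [Ixy nIx nIy]]]] := ideal_prime_or_split idI.
- exists [::] => p /(_ 1 I1); have [[_ /negPf]] := h1_prime p.
  by move=> ->.
- have [[p0 p0P]|nP] := pselect (exists p0 : height1_prime A, P = p0).
    exists [:: p0] => p Ip; rewrite inE; apply/eqP; symmetry.
    by apply: height1_sub_eq => x; rewrite -p0P => Px; apply: Ip; rewrite IP.
  exists [::] => p Ip; case: nP; exists p; apply: height1_above => //.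
    by rewrite -IP.
  by move=> x Px; apply: Ip; rewrite IP.
have subI : is_submod (I : A^o -> Prop) by [].
have idadj z : is_ideal (adjoin (I : A^o -> Prop) z).
  exact: (adjoin_submod subI (z : A^o)).
have nzadj z : nonzero_ideal (adjoin (I : A^o -> Prop) z).
  by have [w Iw w0] := nzI; exists w => //; apply: sub_adjoin.
have step z : ~ I z -> exists s : seq (height1_prime A),
    forall p : height1_prime A,
    (forall w, adjoin (I : A^o -> Prop) z w -> w \in (p : {pred A})) ->
    p \in s.
  move=> nIz; apply: (IH _ (idadj z)); last exact: nzadj.
    by move=> w Iw; apply: sub_adjoin.
  by exists z => //; apply: (mem_adjoin subI).
have [s sP] := step x nIx; have [s' s'P] := step y nIy.
have inadj (p : height1_prime A) z : (forall w, I w -> w \in (p : {pred A})) ->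
    z \in (p : {pred A}) ->
    forall w, adjoin (I : A^o -> Prop) z w -> w \in (p : {pred A}).
  move=> Ip pz w [a /Ip h]; have [[_ _ plin] _] := h1_prime p.
  have := plin a _ _ pz h; by rewrite addrC subrK.
exists (s ++ s') => p Ip; rewrite mem_cat; apply/orP.
have [_ /(_ _ _ (Ip _ Ixy))/orP[px|py]] := h1_prime p; [left|right].
  exact/sP/inadj.
exact/s'P/inadj.
Qed.

End HeightOne.

(** * Divisors of ideals *)

Section Divisors.
Variable A : comNzRingType.
Hypothesis domA : forall x y : A, x * y = 0 -> x = 0 \/ y = 0.
Hypothesis noethA : noetherian A.
Hypothesis regA : forall p : height1_prime A, exists q, local_uniformizer p q.

Let nzp (p : height1_prime A) := height1_nonzero (h1_height p).

Lemma h1_ord_exists (p : height1_prime A) x : x != 0 -> exists m, has_ord p x m.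
Proof.
have [q uq] := regA p; exact: (has_ord_exists domA noethA (h1_prime p) uq).
Qed.

Lemma h1_ideal_ord_exists (p : height1_prime A) I :
  nonzero_ideal I -> exists m, ideal_ord p I m.
Proof.
have [q uq] := regA p; exact: (ideal_ord_exists domA noethA (h1_prime p) uq).
Qed.

Lemma h1_ideal_ord_uniq (p : height1_prime A) I m n :
  ideal_ord p I m -> ideal_ord p I n -> m = n.
Proof. have [q uq] := regA p; exact: (ideal_ord_uniq (h1_prime p) uq). Qed.

Lemma h1_local_pow1 (p : height1_prime A) x :
  in_local_pow p 1 x -> x \in (p : {pred A}).
Proof.
have [q uq] := regA p.
move=> /(in_local_powE (h1_prime p) uq)[s [t [ps e]]].
have [[p0 _ plin] pprime] := h1_prime p.
have : s * x \in (p : {pred A}).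
  rewrite e expr1; have := plin t q 0 (proj1 uq) p0; rewrite addr0.
  exact.
by move/pprime; rewrite (negPf ps).
Qed.

Lemma h1_ideal_ord0 (p : height1_prime A) (I : A -> Prop) x :
  I x -> x \notin (p : {pred A}) -> ideal_ord p I 0.
Proof.
have [q uq] := regA p; move=> Ix px; split.
  by move=> y _; apply: (local_pow_0 (h1_prime p) uq).
by exists x => // /h1_local_pow1; apply/negP.
Qed.

Lemma h1_ideal_ord_self (p : height1_prime A) :
  ideal_ord p (fun x => x \in (p : {pred A})) 1.
Proof.
have [q uq] := regA p; have p1 : 1 \notin (p : {pred A}).
  by case: (h1_prime p) => -[].
split=> [x px|].
  apply/(in_local_powE (h1_prime p) uq); have [_ /(_ x px)[s [t [ps e]]]] := uq.
  by exists s, t; rewrite expr1.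
exists q; first by case: uq.
have /(has_ordE domA (h1_prime p) uq (nzp p))[] // : exists s t,
  [/\ s \notin (p : {pred A}), t \notin (p : {pred A}) & s * q = t * q ^+ 1].
by exists 1, 1; rewrite expr1.
Qed.

Definition is_divisor (I : A -> Prop) (D : {freeg height1_prime A}) : Prop :=
  forall p : height1_prime A, exists2 m, ideal_ord p I m & coeff p D = m%:Z.

Lemma is_divisor_uniq I D D' : is_divisor I D -> is_divisor I D' -> D = D'.
Proof.
move=> DI DI'; apply/eqP/freeg_eqP => p.
have [m om ->] := DI p; have [n on ->] := DI' p.
by rewrite (h1_ideal_ord_uniq om on).
Qed.

Lemma is_divisor_exists I : is_ideal I -> nonzero_ideal I ->
  exists D, is_divisor I D.
Proof.
move=> idI nzI; have [s sP] := height1_over_finite domA noethA idI nzI.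
have ordI (p : height1_prime A) : {m | ideal_ord p I m}.
  by apply: cid; apply: h1_ideal_ord_exists.
exists (\sum_(p <- undup s) << (sval (ordI p))%:Z *g p >>) => p.
exists (sval (ordI p)); first exact: svalP.
rewrite raddf_sum /=; under eq_bigr do rewrite coeffU.
have [ps|ps] := boolP (p \in s).
  rewrite (bigD1_seq p) ?undup_uniq ?mem_undup //= eqxx mulr1 big1 ?addr0 //.
  by move=> p' /negPf ->; rewrite mulr0.
have -> : sval (ordI p) = 0%N.
  case: (ordI p) => m /= om; apply: h1_ideal_ord_uniq om _.
  have [x Ix px] : exists2 x, I x & x \notin (p : {pred A}).
    apply: contrapT => nx; move/negP: ps; apply; apply: sP => x Ix.
    by apply: contrapT => /negP px; apply: nx; exists x.
  exact: h1_ideal_ord0 px.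
rewrite big1_seq // => p' /andP[_]; rewrite mem_undup => p's.
case: eqP => [e|_]; last by rewrite mulr0.
by move: ps; rewrite -e p's.
Qed.

(* Junk value 0 when I is not a nonzero ideal.                                *)
Definition ideal_divisor (I : A -> Prop) : {freeg height1_prime A} :=
  if pselect (exists D, is_divisor I D) is left h then sval (cid h) else 0.

Lemma ideal_divisorP I : is_ideal I -> nonzero_ideal I ->
  is_divisor I (ideal_divisor I).
Proof.
move=> idI nzI; rewrite /ideal_divisor; case: pselect => [h|[]]; last first.
  exact: is_divisor_exists.
exact: svalP.
Qed.

Lemma ideal_divisorE I D : is_divisor I D -> ideal_divisor I = D.
Proof.
rewrite /ideal_divisor => DI; case: pselect => [h|[]]; last by exists D.
exact: is_divisor_uniq (svalP (cid h)) DI.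
Qed.

Lemma is_divisor_h1 (p : height1_prime A) :
  is_divisor (fun x => x \in (p : {pred A})) << p >>.
Proof.
move=> p'; rewrite coeffU mul1r; have [<-|pp'] := eqVneq p p'.
  by exists 1%N => //; apply: h1_ideal_ord_self.
exists 0%N => //.
have [x px p'x] : exists2 x, x \in (p : {pred A}) & x \notin (p' : {pred A}).
  apply: contrapT => nx; move/eqP: pp'; apply; apply: height1_sub_eq => //.
  by move=> x px; apply: contrapT => /negP p'x; apply: nx; exists x.
exact: h1_ideal_ord0 p'x.
Qed.

Lemma is_divisor0 (I : A -> Prop) :
  (forall p : height1_prime A, exists2 x, I x & x \notin (p : {pred A})) ->
  is_divisor I 0.
Proof.
move=> nI p; rewrite coeff0; exists 0%N => //.
by have [x Ix px] := nI p; apply: h1_ideal_ord0 px.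
Qed.

Definition principal_ideal (x : A) : A -> Prop := fun z => exists a, z = a * x.

Lemma principal_is_ideal x : is_ideal (principal_ideal x).
Proof.
split; first by exists 0; rewrite mul0r.
by move=> a _ _ [b ->] [c ->]; exists (a * b + c); rewrite mulrDl mulrA.
Qed.

Lemma principal_nonzero x : x != 0 -> nonzero_ideal (principal_ideal x).
Proof. by exists x => //; exists 1; rewrite mul1r. Qed.

Lemma principal_ideal_ord (p : height1_prime A) x m :
  has_ord p x m -> ideal_ord p (principal_ideal x) m.
Proof. have [q uq] := regA p; exact: (ideal_ord_principal (h1_prime p) uq). Qed.

Lemma principal_divisorE D : principal_divisor D <->
  exists x y, [/\ x != 0, y != 0 &
    D = ideal_divisor (principal_ideal x) - ideal_divisor (principal_ideal y)].
Proof.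
have coefE x (p : height1_prime A) : x != 0 -> exists2 m, has_ord p x m &
    coeff p (ideal_divisor (principal_ideal x)) = m%:Z.
  move=> x0; have [m om] := h1_ord_exists p x0; exists m => //.
  have := ideal_divisorP (principal_is_ideal x) (principal_nonzero x0).
  move=> /(_ p)[n on ->].
  by rewrite (h1_ideal_ord_uniq on (principal_ideal_ord om)).
split=> -[x [y [x0 y0 DE]]]; exists x, y; split=> //; last first.
  move=> p; have [m om mE] := coefE x p x0; have [n on nE] := coefE y p y0.
  by exists m, n; rewrite DE coeffB mE nE.
apply/eqP/freeg_eqP => p; have [m [n [om on ->]]] := DE p.
have [m' om' mE] := coefE x p x0; have [n' on' nE] := coefE y p y0.
rewrite coeffB mE nE.
have -> := h1_ideal_ord_uniq (principal_ideal_ord om) (principal_ideal_ord om').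
by have -> :=
  h1_ideal_ord_uniq (principal_ideal_ord on) (principal_ideal_ord on').
Qed.

Lemma goursat_divisor (N : A -> A -> Prop) : N 0 0 ->
  (forall a x1 x2 y1 y2, N x1 x2 -> N y1 y2 ->
     N (a * x1 + y1) (a * x2 + y2)) ->
  nonzero_ideal (fun a => N a 0) -> nonzero_ideal (fun b => N 0 b) ->
  ideal_divisor (fun a => N a 0) + ideal_divisor (fun b => exists a, N a b) =
  ideal_divisor (fun b => N 0 b) + ideal_divisor (fun a => exists b, N a b).
Proof.
move=> N0 Nlin [a Na a0] [b Nb b0]; apply/eqP/freeg_eqP => p.
have idI1 : is_ideal (fun a => N a 0).
  by split=> // c x y Nx Ny; have := Nlin c _ _ _ _ Nx Ny; rewrite mulr0 addr0.
have idI2 : is_ideal (fun b => N 0 b).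
  by split=> // c x y Nx Ny; have := Nlin c _ _ _ _ Nx Ny; rewrite mulr0 addr0.
have idJ1 : is_ideal (fun a => exists b, N a b).
  split=> [|c x y [z Nx] [w Ny]]; first by exists 0.
  by exists (c * z + w); apply: Nlin.
have idJ2 : is_ideal (fun b => exists a, N a b).
  split=> [|c x y [z Nx] [w Ny]]; first by exists 0.
  by exists (c * z + w); apply: Nlin.
have [|m1 o1 e1] := ideal_divisorP idI1 _ p; first by exists a.
have [|m2 o2 e2] := ideal_divisorP idI2 _ p; first by exists b.
have [|n1 o1' e1'] := ideal_divisorP idJ1 _ p.
  by exists a; first exists 0.
have [|n2 o2' e2'] := ideal_divisorP idJ2 _ p.
  by exists b; first exists 0.
rewrite !coeffD e1 e2 e1' e2' -!PoszD; congr Posz.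
have [q uq] := regA p.
exact: (goursat_ord domA noethA (h1_prime p) uq (nzp p) Nlin N0 o1 o1' o2 o2').
Qed.

Definition cl (D : {freeg height1_prime A}) : Cl A := \pi D.

Lemma clD D D' : cl (D + D') = cl D + cl D'.
Proof. exact: (raddfD \pi_(Quotient.quot (zspan (@principal_divisor A)))). Qed.

Lemma clB D D' : cl (D - D') = cl D - cl D'.
Proof. exact: (raddfB \pi_(Quotient.quot (zspan (@principal_divisor A)))). Qed.

Lemma cl0 : cl 0 = 0.
Proof. by have := clB 0 0; rewrite !subrr. Qed.

Lemma cl_principal D : principal_divisor D -> cl D = 0.
Proof.
move=> pD; apply/eqP; rewrite -cl0 /cl -Quotient.idealrBE subr0.
by apply/asboolP => N _; apply.
Qed.

(** The rank and the first Chern class of A / I. *)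
Definition rank_c1 (I : A -> Prop) : int * Cl A :=
  if `[< nonzero_ideal I >] then (0, cl (ideal_divisor I)) else (1, 0).

Lemma rank_c1_nonzero I :
  nonzero_ideal I -> rank_c1 I = (0, cl (ideal_divisor I)).
Proof. by rewrite /rank_c1; case: asboolP. Qed.

Lemma rank_c1_zero I : ~ nonzero_ideal I -> rank_c1 I = (1, 0).
Proof. by rewrite /rank_c1; case: asboolP. Qed.

Lemma rank_c1_full : rank_c1 (fun=> True) = 0.
Proof.
rewrite rank_c1_nonzero; last by exists 1; rewrite ?oner_eq0.
rewrite (ideal_divisorE (D := 0)) ?cl0 //; apply: is_divisor0 => p.
by exists 1 => //; case: (h1_prime p) => -[].
Qed.

(** As x I = y J, the divisors of I and J differ by the divisor of y / x. *)
Lemma cl_ideal_divisor_scale (I J : A -> Prop) x y :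
  is_ideal I -> is_ideal J -> nonzero_ideal I -> nonzero_ideal J ->
  x != 0 -> y != 0 ->
  (forall z, (exists2 w, I w & z = x * w) <-> (exists2 w, J w & z = y * w)) ->
  cl (ideal_divisor I) = cl (ideal_divisor J).
Proof.
move=> idI idJ nzI nzJ x0 y0 IJ; apply/eqP; rewrite -subr_eq0 -clB; apply/eqP.
apply: cl_principal; exists y, x; split=> // p.
have [mx ox] := h1_ord_exists p x0; have [my oy] := h1_ord_exists p y0.
exists my, mx; split=> //; rewrite coeffB.
have [m om ->] := ideal_divisorP idI nzI p.
have [n on ->] := ideal_divisorP idJ nzJ p.
have [q uq] := regA p.
have := ideal_ord_scale domA (h1_prime p) uq (nzp p) ox oy IJ om on.
lia.
Qed.

(** Here N lies in A x 0: for (b, c) in N, the combination a (b, c) - b (a, 0) = (0, a c) is in N,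
    so c = 0. Thus both ideals of second coordinates are zero and both ideals of first coordinates
    agree. *)
Lemma rank_c1_goursat_degenerate (N : A -> A -> Prop) : N 0 0 ->
  (forall a x1 x2 y1 y2, N x1 x2 -> N y1 y2 ->
     N (a * x1 + y1) (a * x2 + y2)) ->
  nonzero_ideal (fun a => N a 0) -> ~ nonzero_ideal (fun b => N 0 b) ->
  rank_c1 (fun a => N a 0) + rank_c1 (fun b => exists a, N a b) =
  rank_c1 (fun b => N 0 b) + rank_c1 (fun a => exists b, N a b).
Proof.
move=> N0 Nlin [a Na a0] zI2.
have N2 b c : N b c -> c = 0.
  move=> Nbc; have [//|c0] := eqVneq c 0; case: zI2; exists (a * c).
    have := Nlin (- b) _ _ _ _ Na (Nlin a _ _ _ _ Nbc N0).
    by rewrite !addr0 mulr0 add0r mulNr mulrC addNr.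
  exact: dom_mulf_neq0.
rewrite (rank_c1_zero zI2) (_ : (fun a => exists b, N a b) = (fun a => N a 0)).
  have zJ2 : ~ nonzero_ideal (fun b => exists a, N a b).
    by move=> -[b [c /N2 ->]]; rewrite eqxx.
  by rewrite (rank_c1_zero zJ2) addrC.
apply/funext => b; apply/propext; split=> [[c Nbc]|]; last by exists 0.
by rewrite -(N2 _ _ Nbc).
Qed.

(** If N meets both axes nontrivially, it has rank two and [goursat_divisor] applies; if it meets
    just one, it lies in that axis. If it meets neither, both projections are injective on N, and N
    is zero or its two projections are proportional ideals. *)
Lemma rank_c1_goursat (N : A -> A -> Prop) : N 0 0 ->
  (forall a x1 x2 y1 y2, N x1 x2 -> N y1 y2 ->
     N (a * x1 + y1) (a * x2 + y2)) ->
  rank_c1 (fun a => N a 0) + rank_c1 (fun b => exists a, N a b) =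
  rank_c1 (fun b => N 0 b) + rank_c1 (fun a => exists b, N a b).
Proof.
move=> N0 Nlin.
have [nzI1|zI1] := pselect (nonzero_ideal (fun a => N a 0));
have [nzI2|zI2] := pselect (nonzero_ideal (fun b => N 0 b)).
- have nzJ1 : nonzero_ideal (fun a => exists b, N a b).
    by case: nzI1 => a Na a0; exists a => //; exists 0.
  have nzJ2 : nonzero_ideal (fun b => exists a, N a b).
    by case: nzI2 => a Na a0; exists a => //; exists 0.
  rewrite !rank_c1_nonzero //; congr (_, _); rewrite -!clD.
  by rewrite goursat_divisor.
- exact: rank_c1_goursat_degenerate.
- symmetry; apply: (@rank_c1_goursat_degenerate (fun x y => N y x)) => //.
  by move=> a x1 x2 y1 y2; apply: Nlin.
have N10 x y : N x y -> y = 0 -> x = 0.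
  move=> Nxy y0; apply/eqP; apply: contrapT => /negP x0.
  by apply: zI1; exists x; rewrite // -y0.
have N20 x y : N x y -> x = 0 -> y = 0.
  move=> Nxy x0; apply/eqP; apply: contrapT => /negP y0.
  by apply: zI2; exists y; rewrite // -x0.
rewrite !(rank_c1_zero zI1, rank_c1_zero zI2); congr (_ + _).
have [[x [y Nxy] x0]|zJ1] := pselect (nonzero_ideal (fun a => exists b, N a b)).
  have y0 : y != 0 by apply: contra_neq x0; apply: N10 Nxy.
  (* The combination x (z, w) - z (x, y) has first coordinate 0, so its second coordinate vanishes
     too. *)
  have prop z w : N z w -> x * w = y * z.
    move=> Nzw; apply/eqP; rewrite -subr_eq0; apply/eqP.
    have := Nlin (- z) _ _ _ _ Nxy (Nlin x _ _ _ _ Nzw N0).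
    rewrite !addr0 => /N20 h.
    have -> : x * w - y * z = - z * y + x * w by ring.
    by apply: h; ring.
  rewrite !rank_c1_nonzero; last first.
  - by exists y => //; exists x.
  - by exists x => //; exists y.
  congr (_, _); apply: (@cl_ideal_divisor_scale _ _ x y) => //.
  - split=> [|c z w [z' Nz] [w' Nw]]; first by exists 0.
    by exists (c * z' + w'); apply: Nlin.
  - split=> [|c z w [z' Nz] [w' Nw]]; first by exists 0.
    by exists (c * z' + w'); apply: Nlin.
  - by exists y => //; exists x.
  - by exists x => //; exists y.
  - move=> z; split=> -[w [w' Nw] ->]; exists w'; try by exists w.
      exact: prop.
    by symmetry; apply: prop.
rewrite !rank_c1_zero // => -[y [x Nxy] y0]; case: zJ1.
exists x; first by exists y.
by apply: contra_neq y0; apply: N20 Nxy.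
Qed.

End Divisors.

(** * The Grothendieck group and the class group *)

Section CyclicClasses.
Variable A : comNzRingType.

(** Multiplication by y is injective on A / I, so [A/I] = [A/I] + [A/(I + A y)]. *)
Lemma cyclic_class_regular (I : A -> Prop) (y : A) : is_ideal I ->
  (forall a, I (a * y) -> I a) ->
  cyclic_class (fun z => exists a, I (z - a * y)) = 0.
Proof.
move=> idI regy; have := cyclic_class_split y idI.
have -> : colon (I : A^o -> Prop) (y : A^o) = I.
  apply/funext => a; apply/propext; split; first exact: regy.
  move=> Ia; rewrite /colon; have [I0 Ilin] := idI.
  by have := Ilin y a 0 Ia I0; rewrite addr0 mulrC.
by rewrite -[X in X = _ -> _]addr0 => /addrI.
Qed.

Lemma colon_sum_morph (H H' : zmodType) (f : {additive H -> H'})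
    (e : (A -> Prop) -> H) (e' : (A -> Prop) -> H') (V : lmodType A)
    (W : V -> Prop) g :
  is_submod W -> (forall I, is_ideal I -> f (e I) = e' I) ->
  f (colon_sum e W g) = colon_sum e' W g.
Proof.
move=> subW fe; elim: g W subW => [|x g IH] W subW /=; first exact: raddf0.
rewrite raddfD IH; last exact: adjoin_submod.
by congr (_ + _); apply/fe/colon_ideal.
Qed.

Lemma fg_invariant_cyclic (H : zmodType) (e : (A -> Prop) -> H)
    (I : A -> Prop) (idI : is_ideal I) :
  fg_invariant e (quot_fg (row_ideal_submod idI)) = e I.
Proof.
rewrite fg_invariant_rels enum_ordSl enum_ord0 /= addr0; congr e.
apply/funext => a; rewrite /colon !mxE !eqxx mulr1.
by apply/propext; split=> /asboolP.
Qed.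

End CyclicClasses.

Section GrothendieckClassGroup.
Variable A : comNzRingType.
Hypothesis domA : forall x y : A, x * y = 0 -> x = 0 \/ y = 0.
Hypothesis noethA : noetherian A.
Hypothesis regA : forall p : height1_prime A, exists q, local_uniformizer p q.
Hypothesis smallA : forall P : {pred A}, prime_ideal P ->
  nonzero_ideal (fun x => x \in P) -> ~ has_height P 1 ->
  cyclic_class (fun x => x \in P) = 0.

(** Noetherian induction. For a prime I this is the choice of [f] or the hypothesis [smallA].
    Otherwise x y is in I for some x, y outside I; then I : y and I + A y are strictly larger than
    I, and both sides of the identity for I are the sums of those for these two ideals. *)
Lemma cyclic_class_divisor (f : {additive {freeg height1_prime A} -> G0 A})
    (I : A -> Prop) :
  (forall p : height1_prime A,
     f << p >> = cyclic_class (fun x => x \in (p : {pred A}))) ->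
  is_ideal I -> nonzero_ideal I ->
  f (ideal_divisor I) = cyclic_class I.
Proof.
move=> fE; move: I; apply: (noetherian_ind noethA) => I idI IH nzI.
have div0 : ideal_divisor (fun _ : A => True) = 0.
  apply: (ideal_divisorE regA); apply: (is_divisor0 regA) => p.
  by exists 1 => //; case: (h1_prime p) => -[].
have [I1|[P primeP IP]|[x [y [Ixy nIx nIy]]]] := ideal_prime_or_split idI.
- have -> : I = (fun=> True).
    apply/funext => x; apply/propext; split=> // _; have [I0 Ilin] := idI.
    by have := Ilin x 1 0 I1 I0; rewrite mulr1 addr0.
  by rewrite cyclic_class_full div0 raddf0.
- rewrite IP in nzI *; have [htP|nhtP] := pselect (has_height P 1).
    pose p := Height1Prime primeP htP.
    have /(ideal_divisorE regA) -> := is_divisor_h1 domA regA p.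
    exact: fE.
  rewrite smallA // (ideal_divisorE regA (D := 0)) ?raddf0 //.
  apply: (is_divisor0 regA) => p; apply: contrapT => nx; apply: nhtP.
  rewrite (height1_above domA primeP nzI (p := p)); first exact: h1_height p.
  by move=> x Px; apply: contrapT => /negP px; apply: nx; exists x.
have subI : is_submod (I : A^o -> Prop) by [].
have idc : is_ideal (colon (I : A^o -> Prop) (y : A^o)) := colon_ideal subI _.
have ida : is_ideal (adjoin (I : A^o -> Prop) (y : A^o)) :=
  adjoin_submod subI _.
have Ic z : I z -> colon (I : A^o -> Prop) (y : A^o) z.
  move=> Iz; have [I0 Ilin] := idI; rewrite /colon.
  by have := Ilin y z 0 Iz I0; rewrite addr0 mulrC.
have Ia z : I z -> adjoin (I : A^o -> Prop) (y : A^o) z.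
  by move=> Iz; apply: sub_adjoin.
have [w Iw w0] := nzI.
have nzc : nonzero_ideal (colon (I : A^o -> Prop) (y : A^o)).
  by exists w => //; apply: Ic.
have nza : nonzero_ideal (adjoin (I : A^o -> Prop) (y : A^o)).
  by exists w => //; apply: Ia.
rewrite (cyclic_class_split y idI) -(IH _ idc Ic) //; last by exists x.
rewrite -(IH _ ida Ia) //; last by exists y => //; apply: (mem_adjoin subI).
rewrite -raddfD; congr (f _).
(* The divisor of I is the sum of those of I : y and I + A y, by Goursat's identity for the kernel
   of A^2 -> A / I, (a, b) |-> a + b y; its second projection is all of A. *)
have [I0 Ilin] := idI; pose N a b := I (a + b * y).
have N0 : N 0 0 by rewrite /N mul0r addr0.
have Nlin a x1 x2 y1 y2 : N x1 x2 -> N y1 y2 -> N (a * x1 + y1) (a * x2 + y2).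
  move=> Nx Ny; have := Ilin a _ _ Nx Ny.
  by congr I; ring.
have e1 : (fun a => N a 0) = I.
  by apply/funext => a; rewrite /N mul0r addr0.
have e2 : (fun b => N 0 b) = colon (I : A^o -> Prop) (y : A^o).
  by apply/funext => b; rewrite /N add0r.
have e3 : (fun b => exists a, N a b) = (fun=> True).
  apply/funext => b; apply/propext; split=> // _.
  by exists (- b * y); rewrite /N mulNr addNr.
have e4 : (fun a => exists b, N a b) = adjoin (I : A^o -> Prop) (y : A^o).
  apply/funext => a; apply/propext.
  split=> -[b Nb]; exists (- b); move: Nb; rewrite /N ?scaleNr ?opprK //.
  by rewrite mulNr.
have := goursat_divisor domA noethA regA N0 Nlin.
by rewrite e1 e2 e3 e4 div0 addr0; apply.
Qed.

Lemma principal_class0 (x : A) : x != 0 -> cyclic_class (principal_ideal x) = 0.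
Proof.
move=> x0; have idz : is_ideal (fun z : A => z = 0).
  by split=> // a y z -> ->; rewrite mulr0 addr0.
have := @cyclic_class_regular _ _ x idz; rewrite -/(principal_ideal x) => h.
rewrite -[RHS]h; last by move=> a /domA[//|/eqP]; rewrite (negPf x0).
congr cyclic_class; apply/funext => z; apply/propext.
by split=> -[a e]; exists a; [rewrite e subrr | apply/eqP; rewrite -subr_eq0 e].
Qed.

(** The two maps are [phi] = (rank, first Chern class) and [psi] (r, c) = r [A] + [fbar] c. As [psi]
    turns [rank_c1 I] into [A/I], it carries the sum along a filtration that computes [phi] [M] to
    the sum that computes [M] in [G0_class_fg]. The other composite is evaluated on [A] and on the
    classes [A/p]. *)
Theorem G0_iso_Cl :
  exists phi : {additive G0 A -> (int * Cl A)%type}, bijective phi.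
Proof.
have [phi phiE] := G0_invariant (rank_c1_full regA)
  (rank_c1_goursat domA noethA regA).
have [f fE] :=
  freeg_lift (fun p : height1_prime A =>
    cyclic_class (fun x : A => x \in (p : {pred A}))).
have [D|fbar fbarE] := @zquot_lift _ _ (@principal_divisor A) f.
  move=> /(principal_divisorE domA noethA regA)[x [y [x0 y0 ->]]].
  have fpr z : z != 0 -> f (ideal_divisor (principal_ideal z)) = 0.
    move=> z0; rewrite cyclic_class_divisor //.
    - exact: principal_class0.
    - exact: principal_is_ideal.
    - exact: principal_nonzero.
  by rewrite raddfB /= !fpr // subrr.
pose zI : A -> Prop := fun z => z = 0.
have idz : is_ideal zI by split=> // a y z -> ->; rewrite mulr0 addr0.
have nzz : ~ nonzero_ideal zI by move=> [x ->]; rewrite eqxx.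
have nz_zI I : is_ideal I -> ~ nonzero_ideal I -> I = zI.
  move=> [I0 _] nzI; apply/funext => x; apply/propext; split=> [Ix|->//].
  by apply/eqP; apply: contrapT => /negP x0; apply: nzI; exists x.
pose psi (rc : int * Cl A) : G0 A := cyclic_class zI *~ rc.1 + fbar rc.2.
have psiB : zmod_morphism psi.
  move=> [r c] [s d]; rewrite (_ : (r, c) - (s, d) = (r - s, c - d)) //.
  by rewrite /psi /= mulrzBr raddfB opprD addrACA.
pose psiM := GRing.isZmodMorphism.Build _ _ psi psiB.
pose psi' := HB.pack_for {additive (int * Cl A)%type -> G0 A} psi psiM.
have psi_rank I : is_ideal I -> psi (rank_c1 I) = cyclic_class I.
  move=> idI; have [nzI|nzI] := pselect (nonzero_ideal I).
    rewrite rank_c1_nonzero // /psi /= mulr0z add0r fbarE.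
    exact: cyclic_class_divisor.
  rewrite rank_c1_zero // /psi /= raddf0 addr0 mulr1z.
  by rewrite (nz_zI I).
have phi_cyclic I : is_ideal I -> phi (cyclic_class I) = rank_c1 I.
  by move=> idI; rewrite (cyclic_classE idI) phiE fg_invariant_cyclic.
have phi_f D : phi (f D) = (0, cl D).
  have gB : zmod_morphism (fun D : {freeg height1_prime A} => (0 : int, cl D)).
    by move=> D1 D2; rewrite clB; congr (_, _).
  pose gM := GRing.isZmodMorphism.Build _ _ _ gB.
  pose g := HB.pack_for {additive {freeg height1_prime A} -> (int * Cl A)%type}
    (fun D : {freeg height1_prime A} => (0 : int, cl D)) gM.
  apply: (@freeg_additive_eq _ _ (phi \o f) g) => p /=.
  rewrite fE phi_cyclic; last exact: prime_is_ideal (h1_prime p).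
  rewrite rank_c1_nonzero; last exact: height1_nonzero (h1_height p).
  by rewrite (ideal_divisorE regA (is_divisor_h1 domA regA p)).
exists phi, psi => [x|[r c]].
  apply: (@G0_class_additive_eq _ _ (psi' \o phi) idfun) => M /=.
  transitivity (psi (fg_invariant (@rank_c1 A) M)).
    by congr psi; apply: phiE.
  rewrite G0_class_fg.
  exact: (colon_sum_morph (f := psi') _ (zero_submod M) psi_rank).
rewrite /psi /= raddfD raddfMz /= phi_cyclic // rank_c1_zero //.
rewrite -[c]reprK fbarE phi_f.
have hB : zmod_morphism (fun s : int => (s, 0 : Cl A)).
  by move=> s1 s2; congr (_, _); rewrite subrr.
pose h := HB.pack_for {additive int -> (int * Cl A)%type}
  (fun s : int => (s, 0 : Cl A)) (GRing.isZmodMorphism.Build _ _ _ hB).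
have -> : ((1, 0) : int * Cl A) *~ r = (r, 0).
  by rewrite -[LHS](raddfMz h) /= intz.
by congr (_, _); rewrite ?addr0 ?add0r.
Qed.

End GrothendieckClassGroup.

(** * The hypersurface u v = F *)

Section Laurent.
Variables (D : idomainType) (c : D).
Hypothesis c0 : c != 0.

Definition frac_const : {rmorphism D -> {fraction {poly D}}} :=
  @tofrac {poly D} \o polyC.

Definition frac_var : {fraction {poly D}} := tofrac 'X.

Lemma frac_var_neq0 : frac_var != 0.
Proof. by rewrite tofrac_eq0 polyX_eq0. Qed.

Lemma horner_frac_var (p : {poly D}) :
  (map_poly frac_const p).[frac_var] = tofrac p.
Proof.
rewrite /frac_var (map_poly_comp (@tofrac {poly D})) horner_map /=.
by congr tofrac; apply: comp_polyXr.
Qed.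

(** In the Laurent polynomials in T, p(T) has exponents >= 0 and (c/T) q(c/T) has exponents < 0, so
    no cancellation is possible. This gives uniqueness of the normal form p(u) + v q(v). *)
Lemma laurent_eq0 (p q : {poly D}) :
  let V := frac_const c / frac_var in
  (map_poly frac_const p).[frac_var] + V * (map_poly frac_const q).[V] = 0 ->
  p = 0 /\ q = 0.
Proof.
move=> V; rewrite horner_frac_var; set n := size q => pq0.
have VT : V * frac_var = frac_const c by rewrite divfK // frac_var_neq0.
(* T^n (c/T) q(c/T) as a polynomial: the term of index i of q becomes that of degree n - i - 1, with
   the factor c^(i+1). All degrees are below n, while p T^n starts in degree n. *)
pose r := \poly_(i < n) (q`_(n - i.+1) * c ^+ (n - i)).
have rE : tofrac r = frac_var ^+ n * (V * (map_poly frac_const q).[V]).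
  rewrite horner_coef size_map_inj_poly ?rmorph0 //; last first.
    by move=> x y /eqP; rewrite /= tofrac_eq => /eqP/polyC_inj.
  rewrite /r poly_def rmorph_sum !mulr_sumr -/n (reindex_inj rev_ord_inj) /=.
  apply: eq_bigr => -[i ilt] _ /=.
  rewrite coef_map /= subKn // -mul_polyC rmorphM rmorphXn /= -/frac_var.
  have -> : (n - (n - i.+1).+1 = i)%N by lia.
  have -> : frac_var ^+ n = frac_var ^+ (n - i.+1) * frac_var ^+ i.+1.
    by rewrite -exprD; congr (_ ^+ _); lia.
  rewrite polyCM polyC_exp rmorphM rmorphXn /=.
  rewrite -[tofrac c%:P]/(frac_const c) -VT exprMn !exprS.
  ring.
have : p * 'X^n + r = 0.
  apply/eqP; rewrite -(tofrac_eq0 (p * 'X^n + r)) rmorphD rmorphM rmorphXn /=.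
  by rewrite rE -/frac_var mulrC -mulrDr pq0 mulr0.
move=> E; have q0 : q = 0.
  apply/polyP => j; rewrite coef0; have [jn|nj] := ltnP j n; last first.
    by rewrite nth_default.
  have := congr1 (fun s : {poly D} => s`_(n - j.+1)) E.
  rewrite coefD coefMXn coef_poly coef0.
  rewrite (_ : (n - j.+1 < n)%N); last by lia.
  rewrite add0r (_ : (n - (n - j.+1).+1 = j)%N); last by lia.
  by move/eqP; rewrite mulf_eq0 expf_eq0 (negPf c0) andbF orbF => /eqP.
have r0 : r = 0 by apply/polyP => i; rewrite coef_poly q0 !coef0 mul0r if_same.
split=> //; move: E; rewrite r0 addr0 => /eqP.
by rewrite mulf_eq0 expf_eq0 polyX_eq0 andbF orbF => /eqP.
Qed.

End Laurent.

Section Presentation.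
Variables (D : idomainType) (A : comNzRingType) (iota : {rmorphism D -> A}).
Variables (u v : A) (F : D).

Definition eval_at (w : A) : {rmorphism {poly D} -> A} :=
  horner_eval w \o map_poly iota.

(* A = D[u, v] / (u v - F): a normal form for the elements, and the mapping   *)
(* property.                                                                  *)
Definition hypersurface_pres : Prop :=
  [/\ u * v = iota F,
      forall z, exists p q : {poly D}, z = eval_at u p + v * eval_at v q
    & forall (B : comNzRingType) (k : {rmorphism D -> B}) (U V : B),
        U * V = k F ->
        exists h : {rmorphism A -> B}, [/\ forall d, h (iota d) = k d,
          h u = U & h v = V]].

Lemma eval_atE w p : eval_at w p = (map_poly iota p).[w].
Proof. by []. Qed.

Lemma eval_atC w c : eval_at w c%:P = iota c.
Proof. by rewrite eval_atE map_polyC hornerC. Qed.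

Lemma eval_atX w : eval_at w 'X = w.
Proof. by rewrite eval_atE map_polyX hornerX. Qed.

Lemma morph_eval_at (B : comNzRingType) (h : {rmorphism A -> B})
    (k : {rmorphism D -> B}) w p : (forall d, h (iota d) = k d) ->
  h (eval_at w p) = (map_poly k p).[h w].
Proof.
move=> hk; rewrite eval_atE -horner_map -map_poly_comp.
by congr (_.[_]); apply: eq_map_poly.
Qed.

End Presentation.

Section Hypersurface.
Variables (D : idomainType) (A : comNzRingType) (iota : {rmorphism D -> A}).
Variables (u v : A) (F : D).
Hypothesis pres : hypersurface_pres iota u v F.
Let ev := eval_at iota.

(** The normal form favours u only through its constant term: writing p = r X + c moves c from the
    polynomial in u to the one in v. *)
Lemma pres_swap : hypersurface_pres iota v u F.
Proof.
have [uv nf univ] := pres; split.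
- by rewrite mulrC.
- move=> z; have [p [q ->]] := nf z.
  have [r [c ->]] : exists r c, p = r * 'X + c%:P.
    exists (\poly_(i < (size p).-1) p`_i.+1), p`_0; apply/polyP => -[|i].
      by rewrite coefD coefMX coefC add0r.
    rewrite coefD coefMX coefC /= addr0 coef_poly.
    by case: ltnP => // h; rewrite nth_default //; lia.
  exists ('X * q + c%:P), r.
  by rewrite !rmorphD !rmorphM !eval_atX !eval_atC; ring.
- move=> B k U V UV.
  have [|h [hi hu hv]] := univ B k V U; first by rewrite mulrC.
  by exists h.
Qed.

(** Inverting u turns A into D[u, 1/u], because v = F / u. *)
Lemma eval_clear (z : A) : exists k p, u ^+ k * z = ev u p.
Proof.
have [uv nf _] := pres; pose S z := exists k p, u ^+ k * z = ev u p.
have SD x y : S x -> S y -> S (x + y).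
  move=> [k [p e]] [l [q e']]; exists (k + l)%N, ('X^l * p + 'X^k * q).
  rewrite rmorphD !rmorphM !rmorphXn eval_atX -e -e'.
  by rewrite exprD; ring.
have Sv x : S x -> S (v * x).
  move=> [k [p e]]; exists k.+1, (F%:P * p).
  rewrite rmorphM eval_atC -e -uv exprS.
  by ring.
have Si p : S (ev u p) by exists 0%N, p; rewrite mul1r.
have [p [q ->]] := nf z; apply: (SD) => //; apply: (Sv).
elim/poly_ind: q => [|q c IH]; first by rewrite rmorph0 -(rmorph0 (ev u)).
rewrite rmorphD rmorphM eval_atX eval_atC mulrC.
by apply: (SD); [apply: (Sv) | rewrite -(eval_atC iota u)].
Qed.

Hypothesis F0 : F != 0.

(* The embedding of A into the field of fractions of D[T], with u = T and     *)
(* v = F / T.                                                                 *)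
Lemma pres_embed : exists h : {rmorphism A -> {fraction {poly D}}},
  [/\ forall z, h z = 0 -> z = 0, forall d, h (iota d) = frac_const D d
    & h u = frac_var D].
Proof.
have [uv nf univ] := pres.
have [|h [hi hu hv]] := univ _ (frac_const D) (frac_var D)
  (frac_const D F / frac_var D).
  by rewrite mulrC divfK // frac_var_neq0.
exists h; split=> // z; have [p [q ->]] := nf z.
rewrite rmorphD rmorphM !(morph_eval_at _ _ hi) hu hv.
move=> /(laurent_eq0 F0)[-> ->].
by rewrite !rmorph0 mulr0 addr0.
Qed.

Lemma pres_domain (x y : A) : x * y = 0 -> x = 0 \/ y = 0.
Proof.
have [h [hinj _ _]] := pres_embed; move/(congr1 h); rewrite rmorphM rmorph0.
by move/eqP; rewrite mulf_eq0 => /orP[]/eqP/hinj; [left|right].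
Qed.

Lemma eval_at_inj p : ev u p = 0 -> p = 0.
Proof.
have [h [_ hi hu]] := pres_embed => /(congr1 h).
rewrite rmorph0 (morph_eval_at _ _ hi) hu horner_frac_var => /eqP.
by rewrite tofrac_eq0 => /eqP.
Qed.

Lemma iota_inj d : iota d = 0 -> d = 0.
Proof.
by rewrite -(eval_atC iota u) => /eval_at_inj/eqP; rewrite polyC_eq0 => /eqP.
Qed.

(** A is a quotient of D[U][V]. *)
Lemma pres_noetherian : noetherian D -> noetherian A.
Proof.
move=> noethD; have [_ nf _] := pres.
pose f : {rmorphism {poly {poly D}} -> A} := horner_eval v \o map_poly (ev u).
apply: (@surj_noetherian _ _ f); last by apply/poly_noetherian/poly_noetherian.
move=> z; have [p [q ->]] := nf z.
exists (p%:P + 'X * map_poly polyC q).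
have fC p1 : f p1%:P = ev u p1.
  by rewrite -[LHS]/((map_poly (ev u) p1%:P).[v]) map_polyC hornerC.
have fX : f 'X = v.
  by rewrite -[LHS]/((map_poly (ev u) 'X).[v]) map_polyX hornerX.
have fq : f (map_poly polyC q) = ev v q.
  rewrite -[LHS]/((map_poly (ev u) (map_poly polyC q)).[v]) -map_poly_comp.
  by congr (_.[_]); apply: eq_map_poly => c /=; apply: eval_atC.
by rewrite rmorphD rmorphM fC fX fq.
Qed.

End Hypersurface.

Lemma kernel_prime (A : comNzRingType) (B : idomainType)
    (h : {rmorphism A -> B}) : prime_ideal (fun z => h z == 0).
Proof.
split; first split.
- by rewrite unfold_in rmorph0.
- by rewrite unfold_in rmorph1 oner_eq0.
- by move=> a x y; rewrite !unfold_in rmorphD rmorphM => /eqP -> /eqP ->;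
    rewrite mulr0 addr0.
- by move=> x y; rewrite !unfold_in rmorphM mulf_eq0.
Qed.

(** * Primes of the hypersurface over a curve *)

(* The module A / Q is a quotient of the domain A / P by one element, so its  *)
(* class vanishes.                                                            *)
Lemma cyclic_class_over (K : fieldType) (A : comNzRingType)
    (r : {rmorphism {poly K} -> A}) (P Q : {pred A}) :
  prime_ideal P -> prime_ideal Q -> {subset P <= Q} -> ~ {subset Q <= P} ->
  (forall y, exists g y1 y2, y - y1 * r g \in P /\ r g - y2 * y \in P) ->
  cyclic_class (fun z => z \in Q) = 0.
Proof.
move=> primeP primeQ PQ nQP repr_r.
have subE (S : {pred A}) x y :
    prime_ideal S -> x - y \in S -> y \in S -> x \in S.
  by move=> pS xy Sy; rewrite -[x](subrK y); apply: primeD.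
(* By [repr_r], every element is associated modulo P to some [r g]. Euclidean division then shows
   that a nonzero g of least degree with [r g] in Q generates Q modulo P. *)
have ex : exists n, `[< exists g, [/\ g != 0, r g \in Q & size g = n] >].
  apply: contrapT => nex; apply: nQP => y Qy.
  have [g [y1 [y2 [h1 h2]]]] := repr_r y.
  have Qg : r g \in Q by apply: subE (PQ _ h2) _ => //; apply: primeMl.
  have [g0|g0] := eqVneq g 0; first by move: h1; rewrite g0 rmorph0 mulr0 subr0.
  by case: nex; exists (size g); apply/asboolP; exists g.
case: (ex_minnP ex) => n /asboolP[g [g0 Qg sg]] nmin.
have QE z : z \in Q <-> exists a, z - a * r g \in P.
  split=> [Qz|[a h]]; last first.
    by apply: subE (PQ _ h) _ => //; apply: primeMl.
  have [gz [y1 [y2 [h1 h2]]]] := repr_r z.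
  have Qgz : r gz \in Q by apply: subE (PQ _ h2) _ => //; apply: primeMl.
  have gzE := divp_eq gz g.
  have rem0 : gz %% g = 0.
    apply/eqP; apply: contrapT => /negP rem0.
    have : (n <= size (gz %% g)%R)%N.
      apply: nmin; apply/asboolP; exists (gz %% g); split=> //.
      rewrite (_ : gz %% g = gz - gz %/ g * g); last first.
        by rewrite {2}gzE addrAC subrr add0r.
      by rewrite rmorphB rmorphM; apply: primeB => //; apply: primeMl.
    by rewrite -sg leqNgt ltn_modp g0.
  exists (y1 * r (gz %/ g)).
  by rewrite -mulrA -rmorphM; move: h1; rewrite {1}gzE rem0 addr0.
have -> : (fun z => is_true (z \in Q)) = (fun z => exists a, z - a * r g \in P).
  by apply/funext => z; apply/propext.
have idP := prime_is_ideal primeP.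
apply: (cyclic_class_regular idP) => a /=; rewrite primeM // => /orP[//|Pg].
case: nQP => z /QE[b h]; apply: subE h _ => //; exact: primeMl.
Qed.

Section HypersurfaceCurve.
Variables (K : closedFieldType) (A : comNzRingType).
Variables (iota : {rmorphism {poly K} -> A}) (F : {poly K}).
Hypothesis F0 : F != 0.

Lemma prime_contains_linear (P : {pred A}) (g : {poly K}) :
  prime_ideal P -> g != 0 -> iota g \in P ->
  exists m, iota ('X - m%:P) \in P.
Proof.
move=> primeP; have [n] := ubnP (size g); elim: n g => // n IH g sg g0 Pg.
have [/eqP/size_poly1P[c c0 gE]|sg1] := eqVneq (size g) 1%N.
  have : iota (c^-1%:P * g) \in P by rewrite rmorphM primeMl.
  by rewrite gE -polyCM mulVf // rmorph1 (negPf (prime1 primeP)).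
have /closed_rootP[m /factor_theorem[q gE]] := sg1.
have q0 : q != 0 by apply: contraNneq g0 => q0; rewrite gE q0 mul0r.
move: Pg; rewrite gE rmorphM primeM // => /orP[Pq|]; last by exists m.
apply: IH Pq => //; move: sg; rewrite gE size_Mmonic ?monicXsubC //.
by rewrite size_XsubC addn2.
Qed.

Section OneSide.
Variables (u v : A).
Hypothesis pres : hypersurface_pres iota u v F.
Let ev := eval_at iota.
Let domA := pres_domain pres F0.

Lemma eval_at_divisible (m : K) w (p : {poly {poly K}}) :
  map_poly (horner_eval m) p = 0 -> exists a, ev w p = a * iota ('X - m%:P).
Proof.
move=> pm0; exists (ev w (\poly_(i < size p) (p`_i %/ ('X - m%:P)))).
rewrite -(eval_atC iota w) -rmorphM; congr (ev w _).
apply/polyP => i; rewrite coefMC coef_poly; case: ltnP => [_|h]; last first.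
  by rewrite nth_default // mul0r.
rewrite divpK // dvdp_XsubCl; apply/rootP.
by have := congr1 (fun s : {poly K} => s`_i) pm0; rewrite coef0 coef_map.
Qed.

(** Inverting u and the nonzero elements of K[x], all outside P, turns A into the principal ideal
    domain K(x)[u, 1/u]. A nonzero polynomial in u of least degree in P generates P there, by
    pseudo-division. *)
Lemma horizontal_uniformizer (P : {pred A}) : prime_ideal P ->
  nonzero_ideal (fun x => x \in P) ->
  (forall g, g != 0 -> iota g \notin P) -> exists q, local_uniformizer P q.
Proof.
move=> primeP [y0 Py0 y00] hor; have [uv _ _] := pres.
have Pu : u \notin P.
  by apply/negP => Pu; have := hor F F0; rewrite -uv mulrC primeMl.
have PuX k : u ^+ k \notin P by apply: contra Pu; apply: primeX.
have uX0 k : u ^+ k != 0 by apply: contraNneq (PuX k) => ->; apply: prime0.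
have ex : exists n, `[< exists p, [/\ p != 0, ev u p \in P & size p = n] >].
  have [k [p e]] := eval_clear pres y0.
  exists (size p); apply/asboolP; exists p; split=> //.
    apply/eqP => p0; move: e; rewrite p0 rmorph0 => /domA[]/eqP.
      by rewrite (negPf (uX0 k)).
    by rewrite (negPf y00).
  by rewrite /ev -e primeMl.
case: (ex_minnP ex) => n /asboolP[p [p0 Pp sp]] nmin.
exists (ev u p); split=> // y Py.
have [k [py e]] := eval_clear pres y.
have pyE := Pdiv.Idomain.divp_eq py p.
set l := lead_coef p ^+ _ in pyE.
have l0 : l != 0 by rewrite expf_neq0 // lead_coef_eq0.
have rem0 : Pdiv.IdomainDefs.modp py p = 0.
  set rm := Pdiv.IdomainDefs.modp py p in pyE *.
  apply/eqP; apply: contrapT => /negP rm0.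
  have : (n <= size rm)%N.
    apply: nmin; apply/asboolP; exists rm; split=> //.
    have -> : rm = l%:P * py - Pdiv.IdomainDefs.divp py p * p.
      by rewrite mul_polyC pyE addrAC subrr add0r.
    have Ppy : ev u py \in P by rewrite /ev -e primeMl.
    by rewrite rmorphB !rmorphM; apply: primeB => //; apply: primeMl.
  by rewrite -sp leqNgt Pdiv.Idomain.ltn_modp p0.
exists (iota l * u ^+ k), (ev u (Pdiv.IdomainDefs.divp py p)); split.
  by rewrite primeM // negb_or hor // PuX.
rewrite -mulrA e -(eval_atC iota u) -!rmorphM; congr (ev u _).
by rewrite mul_polyC pyE rem0 addr0.
Qed.

(* Here A / (x - m, u) = K[T], and v is invertible at the prime (x - m, u).   *)
Lemma crossing_prime (m : K) (Q : {pred A}) : prime_ideal Q ->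
  F.[m] = 0 -> iota ('X - m%:P) \in Q -> u \in Q ->
  exists P : {pred A}, [/\ prime_ideal P, nonzero_ideal (fun x => x \in P),
    {subset P <= Q}, exists q, local_uniformizer P q
    & {subset Q <= P} \/ cyclic_class (fun x => x \in Q) = 0].
Proof.
move=> primeQ Fm Qm Qu; have [uv nf univ] := pres.
(* The morphism A -> K[T] with x |-> m, u |-> 0, v |-> T is compatible with u v = F because F(m) =
   0. Its kernel P is (x - m, u). *)
pose k : {rmorphism {poly K} -> {poly K}} := polyC \o horner_eval m.
have [|h [hi hu hv]] := univ _ k 0 'X.
  by rewrite mul0r /k /= /horner_eval Fm.
pose P : {pred A} := fun z => h z == 0.
have primeP : prime_ideal P := kernel_prime h.
have hm : h (iota ('X - m%:P)) = 0.
  by rewrite hi /k /= /horner_eval hornerXsubC subrr.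
have hev p q : h (ev u p + v * ev v q) =
    (p`_0).[m]%:P + 'X * map_poly (horner_eval m) q.
  rewrite rmorphD rmorphM !(morph_eval_at _ _ hi) hu hv; congr (_ + _ * _).
    by rewrite horner_coef0 coef_map.
  rewrite /k (map_poly_comp polyC) -/(_ \Po 'X) comp_polyXr //.
have PE z : z \in P -> exists a b, z = a * u + b * iota ('X - m%:P).
  rewrite unfold_in; have [p [q ->]] := nf z; rewrite hev => /eqP e.
  have q0 : map_poly (horner_eval m) q = 0.
    apply/polyP => i; have := congr1 (fun s : {poly K} => s`_i.+1) e.
    by rewrite coefD coefC coefXM !coef0 /= add0r.
  have /eqP : (p`_0).[m]%:P = 0 by move: e; rewrite q0 mulr0 addr0.
  rewrite polyC_eq0 -[_ == 0]/(root _ _) => /factor_theorem[c p0].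
  have [b bE] := eval_at_divisible v q0.
  exists (ev u (\poly_(i < (size p).-1) p`_i.+1)), (iota c + v * b).
  rewrite /ev in bE *; rewrite bE [in RHS]mulrDl -mulrA addrA; congr (_ + _).
  rewrite -(rmorphM iota) -p0 -(eval_atC iota u).
  rewrite -[X in _ * X + _](eval_atX iota).
  rewrite -rmorphM -rmorphD; congr (eval_at iota u _).
  apply/polyP => -[|i]; first by rewrite coefD coefMX coefC add0r.
  rewrite coefD coefMX coefC /= addr0 coef_poly.
  by case: ltnP => // lt; rewrite nth_default //; lia.
have Pm : iota ('X - m%:P) \in P by rewrite unfold_in hm.
have PQ : {subset P <= Q}.
  by move=> z /PE[a [b ->]]; apply: primeD => //; apply: primeMl.
exists P; split=> //.
- exists (iota ('X - m%:P)) => //; apply/eqP => /(iota_inj pres F0)/eqP.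
  by rewrite polyXsubC_eq0.
- exists (iota ('X - m%:P)); split=> // y /PE[a [b ->]].
  have /factor_theorem[F' FE] : root F m by apply/rootP.
  (* From u v = F = F' (x - m): v (a u + b (x - m)) = (a F' + v b) (x - m), and v is outside P.
     Hence x - m is a uniformizer whatever the multiplicity of the root m of F. *)
  exists v, (a * iota F' + v * b); split.
    by rewrite unfold_in hv polyX_eq0.
  rewrite mulrDr mulrCA [v * u]mulrC uv FE rmorphM.
  by ring.
have [QP|nQP] := pselect {subset Q <= P}; [by left | right].
pose r : {rmorphism {poly K} -> A} :=
  horner_eval v \o map_poly (iota \o polyC).
apply: (@cyclic_class_over _ _ r P Q) => // y; exists (h y), 1, 1.
have hr g : h (r g) = g.
  rewrite /r /= /horner_eval -horner_map -map_poly_comp hv.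
  rewrite (@eq_map_poly _ _ _ polyC) ?comp_polyXr //.
    exact: comp_polyXr.
  by move=> c /=; rewrite hi /k /= /horner_eval hornerC.
by rewrite !mul1r !unfold_in !rmorphB hr subrr.
Qed.

End OneSide.
End HypersurfaceCurve.

Section CurveIso.
Variables (K : closedFieldType) (A : comNzRingType).
Variables (iota : {rmorphism {poly K} -> A}) (F : {poly K}) (u v : A).
Hypothesis F0 : F != 0.
Hypothesis pres : hypersurface_pres iota u v F.
Let ev := eval_at iota.

(* Here A / (x - m) = K[T, 1/T].                                              *)
Lemma smooth_fibre_prime (m : K) (Q : {pred A}) : prime_ideal Q ->
  F.[m] != 0 -> iota ('X - m%:P) \in Q ->
  exists P : {pred A}, [/\ prime_ideal P, nonzero_ideal (fun x => x \in P),
    {subset P <= Q}, exists q, local_uniformizer P q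
    & {subset Q <= P} \/ cyclic_class (fun x => x \in Q) = 0].
Proof.
move=> primeQ Fm Qm; have [uv nf univ] := pres.
pose fc := frac_const K; pose T := frac_var K.
pose V := fc F.[m] / T.
have T0 : T != 0 := frac_var_neq0 K.
pose k : {rmorphism {poly K} -> {fraction {poly K}}} := fc \o horner_eval m.
have [|h [hi hu hv]] := univ _ k T V; first by rewrite /V mulrC divfK.
pose P : {pred A} := fun z => h z == 0.
have primeP : prime_ideal P := kernel_prime h.
have hm : h (iota ('X - m%:P)) = 0.
  by rewrite hi /k /= /horner_eval hornerXsubC subrr !rmorph0.
have hev w p : h (ev w p) = (map_poly fc (map_poly (horner_eval m) p)).[h w].
  by rewrite (morph_eval_at _ _ hi) -map_poly_comp.
have PE z : z \in P -> exists a, z = a * iota ('X - m%:P).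
  rewrite unfold_in; have [p [q ->]] := nf z.
  rewrite rmorphD rmorphM !hev hu hv => /eqP/(laurent_eq0 Fm)[p0 q0].
  have [a aE] := eval_at_divisible iota u p0.
  have [b bE] := eval_at_divisible iota v q0.
  by exists (a + v * b); rewrite aE bE; ring.
exists P; split=> //.
- exists (iota ('X - m%:P)); first by rewrite unfold_in hm.
  by apply/eqP => /(iota_inj pres F0)/eqP; rewrite polyXsubC_eq0.
- by move=> z /PE[a ->]; apply: primeMl.
- exists (iota ('X - m%:P)); split=> [|y /PE[a ->]].
    by rewrite unfold_in hm.
  by exists 1, a; split; [apply: prime1 primeP | rewrite mul1r].
have [QP|nQP] := pselect {subset Q <= P}; [by left | right].
pose r : {rmorphism {poly K} -> A} :=
  horner_eval u \o map_poly (iota \o polyC).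
have hr g : h (r g) = (map_poly fc g).[T].
  rewrite /r /= /horner_eval -horner_map -map_poly_comp hu.
  congr (_.[_]); apply: eq_map_poly => c /=.
  by rewrite hi /k /= /horner_eval hornerC.
apply: (@cyclic_class_over _ _ r P Q) => //.
  by move=> z /PE[a ->]; apply: primeMl.
move=> y; have [l [p e]] := eval_clear pres y.
pose g := map_poly (horner_eval m) p.
have hrg : h (r g) = T ^+ l * h y.
  by rewrite hr -hu -rmorphXn -rmorphM e hev hu.
(* Modulo P, [r g] is u^l y, and v / F(m) is the inverse of u. *)
exists g, ((iota (F.[m]^-1)%:P * v) ^+ l), (u ^+ l); split; last first.
  by rewrite unfold_in rmorphB rmorphM rmorphXn hrg hu subrr.
rewrite unfold_in rmorphB rmorphM hrg rmorphXn rmorphM hv hi mulrA -exprMn.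
have -> : k (F.[m]^-1)%:P * V * T = 1.
  have -> : k (F.[m]^-1)%:P = fc F.[m]^-1.
    by rewrite -[LHS]/(fc (horner_eval m _)) /horner_eval hornerC.
  by rewrite -mulrA divfK // -rmorphM mulVf // rmorph1.
by rewrite expr1n mul1r subrr.
Qed.

Lemma fibre_prime (m : K) (Q : {pred A}) : prime_ideal Q ->
  iota ('X - m%:P) \in Q ->
  exists P : {pred A}, [/\ prime_ideal P, nonzero_ideal (fun x => x \in P),
    {subset P <= Q}, exists q, local_uniformizer P q
    & {subset Q <= P} \/ cyclic_class (fun x => x \in Q) = 0].
Proof.
move=> primeQ Qm; have [Fm|Fm] := eqVneq F.[m] 0; last first.
  exact: smooth_fibre_prime Qm.
have : u * v \in Q.
  have [-> _ _] := pres; have /factor_theorem[G ->] : root F m by apply/rootP.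
  by rewrite rmorphM primeMl.
rewrite primeM // => /orP[Qu|Qv].
  exact: (crossing_prime F0 pres primeQ Fm Qm Qu).
exact: (crossing_prime F0 (pres_swap pres) primeQ Fm Qm Qv).
Qed.

(** Provides both conditions of [G0_iso_Cl]. A prime without any x - m meets K[x] in 0. Otherwise Q
    contains a prime P with a uniformizer as in [fibre_prime]; either Q = P, or P shows that Q has
    height other than one and [A/Q] = 0. *)
Lemma prime_dichotomy (Q : {pred A}) : prime_ideal Q ->
  nonzero_ideal (fun x => x \in Q) ->
  (exists q, local_uniformizer Q q) \/
  (~ has_height Q 1 /\ cyclic_class (fun x => x \in Q) = 0).
Proof.
move=> primeQ nzQ.
have [[m Qm]|nQ] := pselect (exists m : K, iota ('X - m%:P) \in Q); last first.
  left; apply: (horizontal_uniformizer F0 pres) => // g g0; apply/negP => Qg.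
  exact/nQ/(prime_contains_linear primeQ g0 Qg).
have [P [primeP nzP PQ [q uq] [QP|cQ]]] := fibre_prime primeQ Qm.
  left; exists q; have <- // : P = Q.
  by apply/funext => x; apply/idP/idP; [apply: PQ | apply: QP].
have [QP|nQP] := pselect {subset Q <= P}.
  left; exists q; have <- // : P = Q.
  by apply/funext => x; apply/idP/idP; [apply: PQ | apply: QP].
right; split=> // htQ; apply: nQP.
exact: (height1_min (pres_domain pres F0) htQ primeP nzP PQ).
Qed.

Theorem curve_G0_iso :
  exists phi : {additive G0 A -> (int * Cl A)%type}, bijective phi.
Proof.
have domA := pres_domain pres F0.
have noethA : noetherian A.
  exact: (pres_noetherian pres (poly_noetherian (field_noetherian (K := K)))).
apply: (G0_iso_Cl domA noethA) => [p|P primeP nzP nhP].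
  have [//|[]] := prime_dichotomy (h1_prime p) (height1_nonzero (h1_height p)).
  by case; apply: h1_height.
have [[q uq]|[]//] := prime_dichotomy primeP nzP.
by case: nhP; apply: uniformizer_height1 uq.
Qed.

End CurveIso.

(** * The hypersurface as a quotient of a polynomial ring *)

Section MpolyMorphisms.
Variables (K : comNzRingType) (n : nat).

Lemma mpoly_gen_ind (T : {mpoly K[n]} -> Prop) :
  (forall c, T c%:MP) -> (forall i, T 'X_i) ->
  (forall p q, T p -> T q -> T (p + q)) ->
  (forall p q, T p -> T q -> T (p * q)) -> forall p, T p.
Proof.
move=> TC TX TD TM; apply: mpolyind => [|c m p _ _ Tp].
  by rewrite -(mpolyC0 n K).
apply: (TD) => //; rewrite -mul_mpolyC mpolyXE_id; apply: (TM) => //.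
elim/big_ind: _ => [|x y|i _]; [by rewrite -(mpolyC1 n K) | exact: TM |].
elim: (m i) => [|k IH]; first by rewrite expr0 -(mpolyC1 n K).
by rewrite exprS; apply: (TM).
Qed.

Lemma mpoly_morph_eq (B : nzRingType) (f g : {rmorphism {mpoly K[n]} -> B}) :
  (forall c, f c%:MP = g c%:MP) -> (forall i, f 'X_i = g 'X_i) -> f =1 g.
Proof.
move=> fgC fgX; apply: mpoly_gen_ind => // p q fgp fgq.
  by rewrite !rmorphD fgp fgq.
by rewrite !rmorphM fgp fgq.
Qed.

End MpolyMorphisms.

Lemma ideal_quot_lift (R B : comNzRingType) (I : idealr R)
    (f : {rmorphism R -> B}) : (forall x, x \in I -> f x = 0) ->
  exists h : {rmorphism {ideal_quot I} -> B}, forall x, h (\pi x) = f x.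
Proof.
move=> fI; pose h (q : {ideal_quot I}) : B := f (repr q).
have hE x : h (\pi x) = f x.
  apply/eqP; rewrite -subr_eq0 -rmorphB; apply/eqP/fI.
  by rewrite Quotient.idealrBE reprK.
have hB : zmod_morphism h.
  move=> x y; rewrite -[x]reprK -[y]reprK -(rmorphB \pi_{ideal_quot I}) !hE.
  exact: rmorphB.
have hM : monoid_morphism h.
  split=> [|x y]; first by rewrite -(rmorph1 \pi_{ideal_quot I}) hE rmorph1.
  by rewrite -[x]reprK -[y]reprK -(rmorphM \pi_{ideal_quot I}) !hE rmorphM.
pose hBM := GRing.isZmodMorphism.Build _ _ h hB.
pose hMM := GRing.isMonoidMorphism.Build _ _ h hM.
by exists (HB.pack_for {rmorphism {ideal_quot I} -> B} h hBM hMM).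
Qed.

Section NonVanishing.
Variable K : closedFieldType.

(** Induction on the number of variables: at a point where the leading coefficient in the last
    variable does not vanish, a nonzero polynomial in one variable remains, and an algebraically
    closed field has a non-root of it. *)
Lemma mpoly_nonvanishing n (p : {mpoly K[n]}) :
  p != 0 -> exists m, p.@[m] != 0.
Proof.
elim: n p => [|n IH] p p0.
  exists (fun=> 0); apply: contraNneq p0 => p0; apply/eqP.
  have E : p = (p.@[fun=> 0])%:MP.
    apply: (@mpoly_morph_eq K 0 _ idfun (@mpolyC 0 K \o meval (fun=> 0))).
      by move=> c /=; rewrite mevalC.
    by case.
  by rewrite E p0 mpolyC0.
pose s : {rmorphism {mpoly K[n.+1]} -> {poly {mpoly K[n]}}} :=
  mmap (polyC \o @mpolyC n K)
    (fun i => if unlift ord_max i is Some j then ('X_j)%:P else 'X).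
pose back : {rmorphism {mpoly K[n]} -> {mpoly K[n.+1]}} :=
  mmap (@mpolyC n.+1 K) (fun j => 'X_(fintype.lift ord_max j)).
pose r : {rmorphism {poly {mpoly K[n]}} -> {mpoly K[n.+1]}} :=
  horner_eval 'X_ord_max \o map_poly back.
have sC c : s c%:MP = (c%:MP)%:P by rewrite /s /= mmapC.
have sX i : s 'X_i = if unlift ord_max i is Some j then ('X_j)%:P else 'X.
  by rewrite /s /= mmapX mmap1U.
have rs : r \o s =1 idfun.
  apply: mpoly_morph_eq => [c|i] /=.
    by rewrite sC /horner_eval map_polyC hornerC /= mmapC.
  rewrite sX; case: unliftP => [j ->|->]; rewrite /horner_eval.
    by rewrite map_polyC hornerC /= mmapX mmap1U.
  by rewrite map_polyX hornerX.
have sp0 : s p != 0.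
  apply: contraNneq p0 => sp; rewrite -[p]/(idfun p) -(rs p).
  by rewrite -[(r \o s) p]/(r (s p)) sp rmorph0.
have [|nu cnu] := IH (lead_coef (s p)); first by rewrite lead_coef_eq0.
have /closed_nonrootP[x nx] : map_poly (meval nu) (s p) != 0.
  apply: contraNneq cnu => /(congr1 (fun q : {poly K} => q`_(size (s p)).-1)).
  by rewrite coef_map coef0 /= -lead_coefE => ->.
exists (fun i => if unlift ord_max i is Some j then nu j else x).
apply: contra nx => /eqP pm; apply/rootP; rewrite -pm.
pose g : {rmorphism {mpoly K[n.+1]} -> K} :=
  horner_eval x \o map_poly (meval nu) \o s.
apply: (@mpoly_morph_eq K n.+1 K g (meval _)) => [c|i] /=.
  by rewrite sC /horner_eval map_polyC hornerC /= !mevalC.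
rewrite sX mevalXU; case: unliftP => [j _|_]; rewrite /horner_eval.
  by rewrite map_polyC hornerC /= mevalXU.
by rewrite map_polyX hornerX.
Qed.

End NonVanishing.

Section HypersurfaceRing.
Variables (K : fieldType) (n t : nat).
Variables (f : 'I_t -> {mpoly K[n]}) (a : 'I_t -> nat).

Let A := hyp_ring f a.

Let quo : {rmorphism {mpoly K[2 + n]} -> A} :=
  \pi_({ideal_quot (hyp_ideal f a)}).

Definition hyp_iota : {rmorphism {mpoly K[n]} -> A} :=
  quo \o comp_mpoly [tuple 'X_(rshift 2 i) | i < n].

Definition hyp_F : {mpoly K[n]} := \prod_(i < t) f i ^+ a i.

Lemma hyp_iotaE p : hyp_iota p = quo (embed_x p). Proof. by []. Qed.

Lemma hyp_uv : quo (var_u K n) * quo (var_v K n) = hyp_iota hyp_F.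
Proof.
rewrite -rmorphM; apply/eqP.
rewrite -[_ == _]/(quo _ == quo _) -subr_eq0 -rmorphB.
have -> : var_u K n * var_v K n - embed_x hyp_F = hyp_eqn f a.
  rewrite /hyp_eqn; congr (_ - _); rewrite /embed_x /hyp_F rmorph_prod.
  by apply: eq_bigr => i _; rewrite rmorphXn.
rewrite -(rmorph0 quo) -Quotient.idealrBE subr0.
by apply/asboolP; exists 1; rewrite mul1r.
Qed.

(** The elements with a normal form include 1 and are stable under addition and under multiplication
    by u, v and the image of C[x_1, ..., x_n], through u v = F. *)
Lemma hyp_normal_form z : exists p q,
  z = eval_at hyp_iota (quo (var_u K n)) p +
      quo (var_v K n) * eval_at hyp_iota (quo (var_v K n)) q.
Proof.
set u := quo _; set v := quo _; pose ev := eval_at hyp_iota.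
pose S z := exists p q, z = ev u p + v * ev v q.
have split_poly (p : {poly {mpoly K[n]}}) : exists r c, p = r * 'X + c%:P.
  elim/poly_ind: p => [|p c _]; last by exists p, c.
  by exists 0, 0; rewrite mul0r add0r.
have SD x y : S x -> S y -> S (x + y).
  move=> [p [q ->]] [p' [q' ->]]; exists (p + p'), (q + q').
  by rewrite !rmorphD; ring.
have Su x : S x -> S (u * x).
  move=> [p [q ->]]; have [r [c ->]] := split_poly q.
  exists ('X * p + (hyp_F * c)%:P), (hyp_F%:P * r).
  rewrite !(rmorphD, rmorphM) !eval_atX !eval_atC -hyp_uv -/u -/v.
  by ring.
have Sv x : S x -> S (v * x).
  move=> [p [q ->]]; have [r [c ->]] := split_poly p.
  exists (hyp_F%:P * r), ('X * q + c%:P).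
  rewrite !(rmorphD, rmorphM) !eval_atX !eval_atC -hyp_uv -/u -/v.
  by ring.
have Si d x : S x -> S (hyp_iota d * x).
  move=> [p [q ->]]; exists (d%:P * p), (d%:P * q).
  by rewrite !rmorphM !eval_atC; ring.
suff Sq (P : {mpoly K[2 + n]}) : forall x, S x -> S (quo P * x).
  have [] := Sq (repr z) 1.
    by exists 1, 0; rewrite !rmorph0 rmorph1 mulr0 addr0.
  move=> p [q e]; exists p, q; rewrite -[RHS]e mulr1.
  by symmetry; apply: (@reprK _ {ideal_quot (hyp_ideal f a)}).
move: P; apply: (@mpoly_gen_ind K (2 + n)).
- move=> c x; have -> : quo c%:MP = hyp_iota c%:MP.
    by rewrite hyp_iotaE /embed_x comp_mpolyC.
  exact: Si.
- move=> i; rewrite -(splitK i); case: (split i) => [j|j] /=.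
    have [->|->] : j = ord0 \/ j = ord_max.
      by case: j => [[|[|k]] klt] //; [left|right]; apply: val_inj.
    - exact: Su.
    - exact: Sv.
  move=> x; have -> : quo 'X_(rshift 2 j) = hyp_iota 'X_j.
    rewrite hyp_iotaE /embed_x comp_mpolyXU -tnth_nth tnth_map.
    by rewrite tnth_ord_tuple.
  exact: Si.
- move=> P1 P2 S1 S2 x Sx; rewrite rmorphD mulrDl.
  by apply: (SD); [apply: S1 | apply: S2].
- by move=> P1 P2 S1 S2 x Sx; rewrite rmorphM -mulrA; apply/S1/S2.
Qed.

Lemma hyp_pres :
  hypersurface_pres hyp_iota (quo (var_u K n)) (quo (var_v K n)) hyp_F.
Proof.
split; [exact: hyp_uv | exact: hyp_normal_form | move=> B k U V UV].
pose w (i : 'I_(2 + n)) : B :=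
  match split i with
  | inl j => if j == ord0 then U else V
  | inr j => k 'X_j
  end.
pose H : {rmorphism {mpoly K[2 + n]} -> B} := mmap (k \o @mpolyC n K) w.
have HX i : H 'X_i = w i by rewrite /H /= mmapX mmap1U.
have HC c : H c%:MP = k c%:MP by rewrite /H /= mmapC.
have Hu : H (var_u K n) = U.
  by rewrite HX /w -[lshift n ord0]/(unsplit (inl ord0)) unsplitK.
have Hv : H (var_v K n) = V.
  by rewrite HX /w -[lshift n ord_max]/(unsplit (inl ord_max)) unsplitK.
have Hx p : H (embed_x p) = k p.
  apply: (@mpoly_morph_eq K n B
    (H \o comp_mpoly [tuple 'X_(rshift 2 i) | i < n]) k) => [c|i] /=.
    by rewrite comp_mpolyC HC.
  rewrite comp_mpolyXU -tnth_nth tnth_map tnth_ord_tuple HX.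
  by rewrite /w -[rshift 2 i]/(unsplit (inr i)) unsplitK.
have HF : H (\prod_(i < t) embed_x (f i) ^+ a i) = k (hyp_F).
  rewrite /hyp_F !rmorph_prod; apply: eq_bigr => i _.
  by rewrite !rmorphXn Hx.
have [x|h hE] := @ideal_quot_lift _ _ (hyp_ideal f a) H.
  move=> /asboolP[q ->]; rewrite rmorphM /hyp_eqn rmorphB rmorphM Hu Hv HF UV.
  by rewrite subrr mulr0.
by exists h; split=> [d||]; rewrite -?Hx -?Hu -?Hv -hE.
Qed.

Lemma hyp_F_neq0 : (forall i, f i != 0) -> hyp_F != 0.
Proof.
by move=> f0; apply/prodf_neq0 => i _; rewrite expf_neq0.
Qed.

End HypersurfaceRing.

Lemma pres_change_base (D D' : idomainType) (A : comNzRingType)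
    (iota : {rmorphism D -> A}) (u v : A) (F : D)
    (s : {rmorphism D -> D'}) (r : {rmorphism D' -> D}) :
  cancel s r -> cancel r s -> hypersurface_pres iota u v F ->
  hypersurface_pres (iota \o r) u v (s F).
Proof.
move=> sK rK [uv nf univ]; split; first by rewrite /= sK.
  have evE w p : eval_at iota w p = eval_at (iota \o r) w (map_poly s p).
    rewrite !eval_atE -map_poly_comp; congr (_.[_]); apply: eq_map_poly => c.
    by rewrite /= sK.
  move=> z; have [p [q ->]] := nf z.
  by exists (map_poly s p), (map_poly s q); rewrite -!evE.
move=> B k U V UV; have [|h [hi hu hv]] := univ B (k \o s) U V; first exact: UV.
by exists h; split=> // d; rewrite /= hi /= rK.
Qed.

(** * The case of one variable *)

Section OneVariable.
Variable K : closedFieldType.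

Definition mpoly1_poly : {rmorphism {mpoly K[1]} -> {poly K}} :=
  mmap polyC (fun=> 'X).

Definition poly_mpoly1 : {rmorphism {poly K} -> {mpoly K[1]}} :=
  horner_eval 'X_ord0 \o map_poly (@mpolyC 1 K).

Lemma mpoly1_polyK : cancel mpoly1_poly poly_mpoly1.
Proof.
move=> p; apply: (@mpoly_morph_eq K 1 _ (poly_mpoly1 \o mpoly1_poly) idfun).
  by move=> c; rewrite /= mmapC /horner_eval map_polyC hornerC.
move=> i; rewrite (ord1 i) /= mmapX mmap1U /horner_eval map_polyX hornerX.
by [].
Qed.

Lemma poly_mpoly1K : cancel poly_mpoly1 mpoly1_poly.
Proof.
move=> p; rewrite /= /horner_eval -horner_map /= mmapX mmap1U -map_poly_comp.
rewrite (@eq_map_poly _ _ _ polyC) ?comp_polyXr //; first exact: comp_polyXr.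
by move=> c /=; rewrite mmapC.
Qed.

Lemma hyp_ring1_G0_iso t (f : 'I_t -> {mpoly K[1]}) (a : 'I_t -> nat) :
  (forall i, f i != 0) ->
  exists phi : {additive G0 (hyp_ring f a) -> (int * Cl (hyp_ring f a))%type},
    bijective phi.
Proof.
move=> f0; have F0 := hyp_F_neq0 a f0.
have pres := pres_change_base mpoly1_polyK poly_mpoly1K (hyp_pres f a).
apply: (curve_G0_iso _ pres).
by apply: contraNneq F0 => e; rewrite -[hyp_F f a]mpoly1_polyK e rmorph0.
Qed.

End OneVariable.

(** * Chains of primes for two or more variables *)

Section SpecializedPrimes.
Variables (D : idomainType) (A : comNzRingType) (iota : {rmorphism D -> A}).
Variables (u v : A) (F : D).
Hypothesis pres : hypersurface_pres iota u v F.

(* P is the kernel of the morphism to Frac D'[T] that maps u to T.            *)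
Lemma specialized_prime (D' : idomainType) (s : {rmorphism D -> D'}) :
  s F != 0 -> exists P : {pred A}, [/\ prime_ideal P,
    forall p q, (eval_at iota u p + v * eval_at iota v q \in P) <->
      map_poly s p = 0 /\ map_poly s q = 0,
    forall d, (iota d \in P) = (s d == 0) & u - 1 \notin P].
Proof.
move=> sF; have [uv nf univ] := pres; pose fc := frac_const D'.
have T0 := frac_var_neq0 D'.
pose k : {rmorphism D -> {fraction {poly D'}}} := fc \o s.
have [|h [hi hu hv]] := univ _ k (frac_var D') (fc (s F) / frac_var D').
  by rewrite mulrC divfK.
have hev w p : h (eval_at iota w p) = (map_poly fc (map_poly s p)).[h w].
  by rewrite (morph_eval_at _ _ hi) -map_poly_comp.
exists (fun z => h z == 0); split.
- exact: kernel_prime.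
- move=> p q; rewrite unfold_in rmorphD rmorphM !hev hu hv; split.
    by move/eqP/(laurent_eq0 sF).
  by move=> [-> ->]; rewrite !rmorph0 !horner0 mulr0 addr0.
- by move=> d; rewrite unfold_in hi /k /= tofrac_eq0 polyC_eq0.
- rewrite unfold_in rmorphB rmorph1 hu -(rmorph1 (@tofrac {poly D'})) -rmorphB.
  by rewrite tofrac_eq0 -polyC1 polyXsubC_eq0.
Qed.

End SpecializedPrimes.

(** At a point m with F(m) nonzero, let P1 be given by x_i = m_i for all i except the first, P2 by x
    = m, and P3 by x = m, u = 1. Then 0, P1, P2, P3 is a chain of primes of length 3. The successive
    inclusions are strict by the elements x_1 - m_1 (counting from 0; this uses a second variable),
    x_0 - m_0 and u - 1. *)
Lemma pres_not_dim2 (K : closedFieldType) n (A : comNzRingType)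
    (iota : {rmorphism {mpoly K[n.+2]} -> A}) (u v : A) (F : {mpoly K[n.+2]}) :
  F != 0 -> hypersurface_pres iota u v F -> ~ has_krull_dim A 2.
Proof.
move=> F0 pres.
have [uv nf univ] := pres.
have [m Fm] := mpoly_nonvanishing F0.
pose s1 : {rmorphism {mpoly K[n.+2]} -> {poly K}} :=
  mmap polyC (fun i : 'I_n.+2 => if i == ord0 then 'X else (m i)%:P).
pose s2 : {rmorphism {mpoly K[n.+2]} -> K} := meval m.
have s1X i : s1 'X_i = if i == ord0 then 'X else (m i)%:P.
  by rewrite /s1 /= mmapX mmap1U.
have s1C c : s1 c%:MP = c%:P by rewrite /s1 /= mmapC.
have s12 p : (s1 p).[m ord0] = s2 p.
  apply: (@mpoly_morph_eq K n.+2 _ (horner_eval (m ord0) \o s1) s2) => [c|i].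
    by rewrite /= s1C /horner_eval hornerC mevalC.
  rewrite /= s1X /horner_eval mevalXU.
  by case: eqP => [->|_]; rewrite ?hornerX ?hornerC.
have s1F : s1 F != 0.
  apply: contraNneq Fm => s1F; apply/eqP.
  by have := s12 F; rewrite s1F horner0 => /esym.
have [P1 [primeP1 P1E P1i _]] := specialized_prime pres s1F.
have [P2 [primeP2 P2E P2i P2u]] := specialized_prime pres (Fm : s2 F != 0).
have [|h [hi hu hv]] := univ _ s2 1 (s2 F); first by rewrite mul1r.
pose P3 : {pred A} := fun z => h z == 0.
have P12 : {subset P1 <= P2}.
  have map12 p : map_poly s1 p = 0 -> map_poly s2 p = 0.
    move=> p0; apply/polyP => i; rewrite coef0 coef_map.
    have e : s1 p`_i = 0.
      have := congr1 (fun q : {poly {poly K}} => q`_i) p0.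
      by rewrite coef_map coef0.
    by have := s12 p`_i; rewrite e horner0 => /esym.
  move=> z; have [p [q ->]] := nf z; move/P1E => [p0 q0].
  by apply/P2E; split; apply: map12.
have P23 : {subset P2 <= P3}.
  move=> z; have [p [q ->]] := nf z; move/P2E => [p0 q0].
  rewrite unfold_in rmorphD rmorphM !(morph_eval_at _ _ hi) p0 q0 !horner0.
  by rewrite mulr0 addr0.
have iX i : s2 ('X_i - (m i)%:MP) = 0.
  by rewrite /s2 /= mevalB mevalXU mevalC subrr.
pose x1 : {mpoly K[n.+2]} := 'X_(inord 1) - (m (inord 1))%:MP.
pose x0 : {mpoly K[n.+2]} := 'X_ord0 - (m ord0)%:MP.
have x1nz : iota x1 != 0.
  apply/eqP => /(iota_inj pres F0) /(congr1 (meval (fun i => m i + 1))).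
  rewrite /x1 mevalB mevalXU mevalC meval0 addrC addrA addNr add0r => /eqP.
  by rewrite oner_eq0.
pose c (i : 'I_4) : {pred A} :=
  if i == 0 :> nat then (pred1 0 : {pred A}) else
  if i == 1 :> nat then P1 else if i == 2 :> nat then P2 else P3.
case=> _ /(_ 3 c); suff h4 : prime_chain c by move=> /(_ h4).
have P01 : strict_sub (pred1 0 : {pred A}) P1.
  split=> [x|/(_ (iota x1))].
    by rewrite inE => /eqP ->; apply: prime0 primeP1.
  have i1 : (inord 1 == ord0 :> 'I_n.+2) = false by rewrite -val_eqE /= inordK.
  rewrite P1i /x1 rmorphB s1X i1 s1C subrr eqxx.
  by move=> /(_ isT); rewrite inE (negPf x1nz).
have nP21 : ~ {subset P2 <= P1}.
  move=> /(_ (iota x0)); rewrite P1i P2i iX eqxx => /(_ isT).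
  by rewrite /x0 rmorphB s1X s1C eqxx polyXsubC_eq0.
have nP32 : ~ {subset P3 <= P2}.
  move=> h32; move/negP: P2u; apply; apply: h32.
  by rewrite unfold_in rmorphB rmorph1 hu subrr.
have nP31 : ~ {subset P3 <= P1}.
  by move=> h31; apply: (nP32) => x /h31; apply: (P12).
have P13 : {subset P1 <= P3} by move=> x /P12/P23.
have [z01 nz01] := P01.
split=> [[[|[|[|i]]] ilt]|[[|[|[|[|i]]]] ilt] [[|[|[|[|j]]]] jlt]] //=.
- exact: zero_prime (pres_domain pres F0).
- exact: kernel_prime.
- move=> _; split=> [x /z01/P12//|h20]; apply: nz01 => x /P12; exact: h20.
- move=> _; split=> [x /z01/P13//|h30]; apply: nz01 => x /P13; exact: h30.
Qed.

Theorem theorem4p2p2 (R : realType) (n t : nat)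
    (f : 'I_t -> {mpoly (complex R)[n]}) (a : 'I_t -> nat)
    (n_ge1 : (1 <= n)%N) (t_ge1 : (1 <= t)%N)
    (f_irr : forall i, irreducible_elt (f i))
    (f_coprime : forall i j, i != j -> coprime_elt (f i) (f j))
    (a_ge1 : forall i, (1 <= a i)%N)
    (dimA : has_krull_dim (hyp_ring f a) 2) :
  exists phi : {additive G0 (hyp_ring f a) -> (int * Cl (hyp_ring f a))%type},
    bijective phi.
Proof.
have f0 i : f i != 0 by case: (f_irr i).
case: n => [|[|n]] in f n_ge1 f_irr f_coprime dimA f0 *; first by [].
  exact: hyp_ring1_G0_iso.
by case: (pres_not_dim2 (hyp_F_neq0 a f0) (hyp_pres f a) dimA).
Qed.
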